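(* Let $K\subset\mathbb{R}^n$ be a closed convex set with diameter $d$, let $c>1$ be a constant, and for $\sigma>0$ define $$\overline{\varepsilon}(\sigma):=\sup\Big\{\varepsilon:\ \sup_{\mu\in K}\Big[w_\mu(\varepsilon)-\inf_{\nu\in B(\mu,\varepsilon)\cap K}w_\nu(\varepsilon/c)\Big]\ge\Big(4+\frac4c\Big)\frac{\varepsilon^2}{2\sigma}\Big\}.$$ Set $\sigma'=4c\sigma/(c-1)$. If $\overline{\varepsilon}(\sigma)\gtrsim\sigma$ for a sufficiently large constant, then $\overline{\varepsilon}(\sigma)/c\le\varepsilon_K(\sigma)\le\overline{\varepsilon}(\sigma')$; if $\overline{\varepsilon}(\sigma')\lesssim\sigma$, then $\varepsilon_K(\sigma)\asymp\sigma\wedge d$.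
   Context: Gaussian sequence model: $Y=\mu+\xi$, $\mu\in K$, $\xi\sim N(0,\sigma^2\mathbb{I}_n)$; LSE $\hat\mu=\operatorname{argmin}_{\nu\in K}\|Y-\nu\|_2^2$; $\varepsilon_K(\sigma)^2=\sup_{\mu\in K}\mathbb{E}_\mu\|\hat\mu-\mu\|_2^2$. Local Gaussian width $w_\mu(\varepsilon)=\mathbb{E}\sup_{t\in B(\mu,\varepsilon)\cap K}\langle x,t\rangle$, $x\sim N(0,\mathbb{I}_n)$, $B$ the closed Euclidean ball. $\lesssim,\asymp$ hide absolute constants. *)

(* Defs.v *)
From HB Require Import structures.
From mathcomp Require Import all_boot all_order all_algebra.
From mathcomp Require Import all_classical all_reals all_analysis.
Set Implicit Arguments. Unset Strict Implicit. Unset Printing Implicit Defensive.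
Import Order.TTheory GRing.Theory Num.Theory.
Import numFieldNormedType.Exports.
Local Open Scope classical_set_scope.
Local Open Scope ring_scope.

Section Defs.
Context {R : realType}.

Definition dotv n (x y : 'rV[R]_n) : R := \sum_(i < n) x ord0 i * y ord0 i.
Definition enorm n (x : 'rV[R]_n) : R := Num.sqrt (dotv x x).

Definition eball n (mu : 'rV[R]_n) (e : R) : set 'rV[R]_n :=
  [set t | enorm (t - mu) <= e].

Definition convex_setE n (K : set 'rV[R]_n) : Prop :=
  forall x y, K x -> K y -> forall t : R, 0 <= t <= 1 ->
    K (t *: x + (1 - t) *: y).

Definition ebounded n (K : set 'rV[R]_n) : Prop :=
  exists M : R, forall x, K x -> enorm x <= M.

Definition diam n (K : set 'rV[R]_n) : R :=
  sup [set enorm (x - y) | x in K & y in K].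

(* Expectation with respect to x ~ N(0, I_n), as an iterated integral
   against the standard normal law on each coordinate. *)
Fixpoint gauss_exp (n : nat) : ('rV[R]_n -> R) -> \bar R :=
  match n return ('rV[R]_n -> R) -> \bar R with
  | 0 => fun f => (f 0)%:E
  | n'.+1 => fun f =>
      (\int[normal_prob (0:R) 1]_(a in [set: R])
         gauss_exp (fun v : 'rV[R]_n' => f (row_mx (a%:M : 'rV[R]_1) v)))%E
  end.

Definition lgw n (K : set 'rV[R]_n) (mu : 'rV[R]_n) (e : R) : \bar R :=
  gauss_exp (fun x => sup [set dotv x t | t in eball mu e `&` K]).

(* least squares estimator: the (unique, for K closed convex nonempty)
   minimizer of ||Y - nu|| over nu in K *)
Definition lse n (K : set 'rV[R]_n) (Y : 'rV[R]_n) : 'rV[R]_n :=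
  xget 0 [set nu | K nu /\ forall t, K t -> enorm (Y - nu) <= enorm (Y - t)].

Definition minimax_sq n (K : set 'rV[R]_n) (sigma : R) : \bar R :=
  ereal_sup [set gauss_exp (fun x => enorm (lse K (mu + sigma *: x) - mu) ^+ 2)
            | mu in K].

Definition epsK n (K : set 'rV[R]_n) (sigma : R) : R :=
  Num.sqrt (fine (minimax_sq K sigma)).

Definition epsbar n (K : set 'rV[R]_n) (c sigma : R) : R :=
  sup [set e : R | 0 <= e /\
     (ereal_sup [set (lgw K mu e -
                      ereal_inf [set lgw K nu (e / c) | nu in eball mu e `&` K])%E
                 | mu in K]
      >= ((4 + 4 / c) * (e ^+ 2 / (2 * sigma)))%:E)%E].

End Defs.

(* Main.v *)
Require Import Defs.
From HB Require Import structures.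
From mathcomp Require Import all_boot all_order all_algebra.
From mathcomp Require Import all_classical all_reals all_analysis.
From mathcomp Require Import measurable_realfun ring lra.
Import Order.TTheory GRing.Theory Num.Theory.
Import numFieldNormedType.Exports.
Local Open Scope classical_set_scope.
Local Open Scope ring_scope.

(* For x standard Gaussian, let F_r = sup <x, t> over t in K with |t - mu| <= r, let w_r = E F_r,
   and let m be the distance from mu to the least squares estimator at mu + sigma x.  F is
   concave in r and the variational inequality of the projection says that m / sigma is a
   supergradient of F at m.  Increments of F are Lipschitz in x, so by Gaussian concentration
   (Maurey's property tau, a tensorized Prekopa-Leindler inequality) they are close to those
   of w.

   Upper bound: if w_rho - w_(rho/c) is small then F has small slope just below rho, which
   keeps m below (1 - kappa) rho up to a fluctuation of order sigma.

   Lower bound: if w_eps(mu) - w_(eps/c)(nu) is large then so is w_(2 eps)(nu) - w_(eps/c)(nu),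
   and m exceeds d = eps/c with high probability.  To get E m >= d with no loss in the
   constant, compare the gain on {m > d + t} with the loss on {m < d}, where t is the scale at
   which w has used up a fixed part of its increment beyond d: if t is small then w is so steep
   at d that the loss is O(t sigma^2 / eps^2), by summing over dyadic deviations 2^j t.

   The bound of order min(sigma, diam K) comes from two points of K at such a distance and the
   Cameron-Martin formula. *)

(** * The standard normal distribution on the line *)

(** An error equal to r corresponds to a slope r / sigma of F, so the natural reference for an
    increment over [rho / c, rho] is the integral of r / sigma, namely (1 - c^-2) rho^2 / (2 sigma).
    The noise level sigma' is the one at which the definition of [epsbar] asks for exactly this
    amount.

    The obstacle is that both inequalities of the first claim carry the constant 1, so nothing may
    be lost. In the upper bound the relative margin kappa = (1 - 1/c)^2 / 4 gained below rho absorbs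
    the fluctuation as soon as rho >= 7 sigma / kappa^2. In the lower bound the condition at noise
    sigma reads (2 + 2/c) eps^2 / sigma; merging the two centres mu and nu enlarges the radius to 2
    eps but leaves this amount intact, and it exceeds what an error near eps / c can account for by
    a multiple of eps^2 / sigma.

    Only variances are used: indicators of tail events are replaced by Chebyshev quotients, which
    stay in a class of functions on which the iterated expectation is finite, linear and monotone.
    Integrals are handled one coordinate at a time, so the order of integration is never
    exchanged. *)

Section StandardNormal.
Context {R : realType}.
Implicit Types (f g h : R -> R) (k x y : R).
Local Notation mu := (@lebesgue_measure R).
Local Notation gam := (@normal_prob R 0 1).
Local Notation pdf := (@normal_pdf R 0 1).

Lemma gam_dominates : gam `<< mu.
Proof. exact: normal_prob_dominates. Qed.

(** The Radon-Nikodym derivative of [gam] agrees with [pdf] almost everywhere, because both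
    integrate to [gam E] over every measurable [E]. *)
Lemma ge0_integral_gauss f : measurable_fun setT f -> (forall x, 0 <= f x) ->
  (\int[gam]_x (f x)%:E = \int[mu]_x (f x * pdf x)%:E)%E.
Proof.
move=> mf f0.
pose rn := @Radon_Nikodym_SigmaFinite.f _ _ R gam mu.
rewrite -(@Radon_Nikodym_SigmaFinite.change_of_variables _ _ R gam mu gam_dominates (EFin \o f)) //; last first.
- exact/measurable_EFinP.
have irn : mu.-integrable setT rn by apply: Radon_Nikodym_SigmaFinite.f_integrable; exact: gam_dominates.
have mpdf : measurable_fun setT (fun x => (pdf x)%:E).
  by apply/measurable_EFinP; exact: measurable_normal_pdf.
apply: ae_eq_integral => //=.
- apply: emeasurable_funM; first exact/measurable_EFinP.
  exact: (measurable_int mu).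
- by apply/measurable_EFinP; apply: measurable_funM => //; exact: measurable_normal_pdf.
- under [X in ae_eq _ _ _ X]eq_fun do rewrite EFinM.
  apply: ae_eqe_mul2l.
  apply: integral_ae_eq => // E _ mE.
  rewrite -(@Radon_Nikodym_SigmaFinite.f_integral _ _ R gam mu gam_dominates) //.
Qed.

Lemma pdfE x : pdf x = normal_peak 1 * expR (- x ^+ 2 / 2).
Proof.
by rewrite normal_pdfE ?oner_eq0 // /normal_fun subr0 expr1n.
Qed.

Lemma pdf_gt0 x : 0 < pdf x.
Proof. by rewrite pdfE mulr_gt0 ?expR_gt0 ?normal_peak_gt0 ?oner_eq0. Qed.

Lemma continuous_pdf : continuous pdf.
Proof. by apply: continuous_normal_pdf; rewrite oner_eq0. Qed.

(** Completing the square; integrating it gives the Laplace transform of the normal law. *)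
Lemma pdf_shift k x : expR (k * x) * pdf x = expR (k ^+ 2 / 2) * normal_pdf k 1 x.
Proof.
rewrite pdfE normal_pdfE ?oner_eq0 // /normal_fun expr1n.
rewrite mulrCA [RHS]mulrCA -!expRD; congr (_ * expR _).
by field.
Qed.

Lemma integral_expR k : (\int[gam]_x (expR (k * x))%:E = (expR (k ^+ 2 / 2))%:E)%E.
Proof.
rewrite ge0_integral_gauss; last 2 first.
- apply: measurableT_comp => //; exact: mulrl_measurable.
- by move=> x; exact: expR_ge0.
under eq_integral do rewrite pdf_shift EFinM.
rewrite integralZl //; last exact: integrable_normal_pdf.
by rewrite integral_normal_pdf mule1.
Qed.

Lemma integrable_expR k : gam.-integrable setT (fun x => (expR (k * x))%:E).
Proof.
apply/integrableP; split.
  by apply/measurable_EFinP; apply: measurableT_comp => //; exact: mulrl_measurable.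
under eq_integral do rewrite /= ger0_norm ?expR_ge0 //.
by rewrite integral_expR ltry.
Qed.

(** [expR (L * |x|)] is at most [expR (L * x) + expR (- L * x)], and both terms are integrable. *)
Lemma integrable_dom f (C L : R) : measurable_fun setT f ->
  (forall x, `|f x| <= C * expR (L * `|x|)) -> gam.-integrable setT (EFin \o f).
Proof.
move=> mf fle.
have C0 : 0 <= C by have := fle 0; rewrite normr0 mulr0 expR0 mulr1; apply: le_trans.
apply: (@le_integrable _ _ _ gam setT measurableT _ (EFin \o (fun x => C * (expR (L * x) + expR (- L * x))))).
- exact/measurable_EFinP.
- move=> x _; rewrite lee_fin; apply: (le_trans (fle x)); apply: (le_trans _ (ler_norm _)).
  rewrite ler_wpM2l // ; case: (ger0P x) => _.
    by rewrite lerDl expR_ge0.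
  by rewrite mulrN -mulNr lerDr expR_ge0.
- have := integrableZl measurableT C (integrableD measurableT (integrable_expR L) (integrable_expR (- L))).
  by apply: eq_integrable => // x _; rewrite /= -EFinM.
Qed.

(** A single estimate yielding both continuity, hence measurability, and integrability; it is the
    one-variable shadow of [tame] below. *)
Definition expgrowth f := exists C L : R, 0 <= C /\ 0 <= L /\
  forall x y, `|f x - f y| <= C * expR (L * (`|x| + `|y|)) * `|x - y|.

Lemma expgrowth_continuous f : expgrowth f -> continuous f.
Proof.
move=> [C [L [C0 [L0 fL]]]] x.
apply/(@cvgrPdist_le _ R^o) => e e0.
pose M := C * expR (L * (`|x| + (`|x| + 1))).
have M0 : 0 <= M by rewrite mulr_ge0 ?expR_ge0.
have M1 : 0 < M + 1 by rewrite ltr_pwDr.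
near=> t.
have h1 : `|x - t| <= 1 by near: t; apply: (@cvgr_dist_le _ R^o) => //.
have h2 : `|x - t| <= e / (M + 1).
  by near: t; apply: (@cvgr_dist_le _ R^o) => //; rewrite divr_gt0.
apply: (le_trans (fL x t)).
have h3 : `|t| <= `|x| + 1.
  have -> : t = x - (x - t) by ring.
  by apply: (le_trans (ler_normB _ _)); rewrite lerD2l.
apply: (@le_trans _ _ (M * `|x - t|)).
  rewrite ler_wpM2r // ler_wpM2l // ler_expR ler_wpM2l // lerD2l //.
apply: (@le_trans _ _ (M * (e / (M + 1)))); first by rewrite ler_wpM2l.
rewrite mulrA ler_pdivrMr // mulrC ler_wpM2l ?ltW //; lra.
Unshelve. all: by end_near. Qed.

Lemma expgrowth_bound f : expgrowth f ->
  exists C L : R, 0 <= C /\ 0 <= L /\ forall x, `|f x| <= C * expR (L * `|x|).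
Proof.
move=> [C [L [C0 [L0 fL]]]].
(* The extra 1 in the rate absorbs the linear factor, since [1 + |x| <= expR |x|]. *)
exists (`|f 0| + C), (L + 1); split; first by rewrite addr_ge0.
split; first by lra.
move=> x; have := fL x 0; rewrite subr0 normr0 addr0 => h.
have -> : f x = f 0 + (f x - f 0) by ring.
apply: (le_trans (ler_normD _ _)); rewrite mulrDl lerD //.
  by rewrite ler_peMr // -expR0 ler_expR mulr_ge0 // addr_ge0.
apply: (le_trans h); rewrite -mulrA ler_wpM2l // mulrDl mul1r expRD.
rewrite ler_wpM2l ?expR_ge0 //; have := expR_ge1Dx `|x|; lra.
Qed.

Lemma integrable_expgrowth f : expgrowth f -> gam.-integrable setT (EFin \o f).
Proof.
move=> gf; have [C [L [_ [_ fle]]]] := expgrowth_bound _ gf.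
apply: (integrable_dom _ C L) => //.
apply: continuous_measurable_fun; exact: expgrowth_continuous.
Qed.

End StandardNormal.

(** * Translations of the normal law *)

Section Shift.
Context {R : realType}.
Implicit Types (f g : R -> R) (k x y : R).
Local Notation mu := (@lebesgue_measure R).
Local Notation gam := (@normal_prob R 0 1).
Local Notation pdf := (@normal_pdf R 0 1).

Lemma pdf_addr k x : pdf (x + k) = expR (- k * x - k ^+ 2 / 2) * pdf x.
Proof.
by rewrite !pdfE mulrCA -expRD; congr (_ * expR _); field.
Qed.

Lemma continuous_shift_weight k : continuous (fun x : R => expR (- k * x - k ^+ 2 / 2)).
Proof.
move=> x; apply: (@continuous_comp _ _ _ (fun x : R => - k * x - k ^+ 2 / 2) expR); last exact: continuous_expR.
apply: (@continuousB R R^o R); last exact: cst_continuous.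
exact: mulrl_continuous.
Qed.

Lemma ge0_integral_gauss_shift f k : continuous f -> (forall x, 0 <= f x) ->
  (\int[gam]_x (f x)%:E =
   \int[gam]_x (f (x + k) * expR (- k * x - k ^+ 2 / 2))%:E)%E.
Proof.
move=> cf f0.
have cshift : continuous (fun x : R => x + k).
  by move=> x; apply: (@continuousD R R^o R) => //; exact: cst_continuous.
have clin := continuous_shift_weight k.
have cfk : continuous (fun x => f (x + k)).
  by move=> x; apply: continuous_comp; [exact: cshift|exact: cf].
rewrite ge0_integral_gauss //; last exact: continuous_measurable_fun.
rewrite ge0_integral_gauss; last 2 first.
- by apply: continuous_measurable_fun => x; exact: (cvgM (cfk x) (clin x)).
- by move=> x; rewrite mulr_ge0 ?expR_ge0.
have dF x : is_derive x 1 (fun x : R => x + k) 1.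
  have := is_deriveD (is_derive_id x (1:R)) (is_derive_cst k x (1:R)).
  by rewrite addr0.
have F'E : ((fun x : R => x + k)^`())%classic = cst 1.
  by apply/funext => x; rewrite derive1E; apply: derive_val.
rewrite (@increasing_ge0_integration_by_substitutionT _ (fun x => x + k) (fun x => f x * pdf x)).
- apply: eq_integral => x _; congr (_%:E).
  by rewrite F'E fctE /= mulr1 pdf_addr mulrA.
- by move=> x y xy; rewrite ltrD2r.
- by rewrite F'E; move=> x; exact: cvg_cst.
- by rewrite F'E; exact: is_cvg_cst.
- by rewrite F'E; exact: is_cvg_cst.
- by move=> x; apply: ex_derive.
- exact: cvg_addrr_Ny.
- exact: cvg_addrr.
- by move=> x; exact: (cvgM (cf x) (continuous_pdf x)).
- by move=> x; rewrite mulr_ge0 // ltW // pdf_gt0.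
Qed.

(* Cauchy-Schwarz against the Cameron-Martin density. *)
Lemma Rintegral_gauss_shift_sqr f k : expgrowth f -> (forall x, 0 <= f x) ->
  (\int[gam]_x f x) ^+ 2 <= expR (k ^+ 2) * \int[gam]_x (f (x + k)) ^+ 2.
Proof.
move=> gf f0; have cf := expgrowth_continuous _ gf.
have [C [L [C0 [L0 fle]]]] := expgrowth_bound _ gf.
have cshift : continuous (fun x : R => x + k).
  by move=> x; apply: (@continuousD R R^o R) => //; exact: cst_continuous.
have cfk : continuous (fun x => f (x + k)).
  by move=> x; apply: continuous_comp; [exact: cshift|exact: cf].
have clin := continuous_shift_weight k.
have cfk2 : continuous (fun x => f (x + k) ^+ 2).
  by move=> x; exact: (cvgM (cfk x) (cfk x)).
have i2 : gam.-integrable setT (EFin \o (fun x => f (x + k) ^+ 2)).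
  apply: (integrable_dom _ (C ^+ 2 * expR (2 * L * `|k|)) (2 * L)).
    exact: continuous_measurable_fun.
  move=> x; rewrite normrX -mulrA -expRD.
  have -> : expR (2 * L * `|k| + 2 * L * `|x|) = expR (L * (`|k| + `|x|)) ^+ 2.
    by rewrite -expRM_natl; congr expR; ring.
  rewrite -exprMn ler_sqr ?nnegrE ?mulr_ge0 ?expR_ge0 //.
  apply: (le_trans (fle _)); rewrite ler_wpM2l // ler_expR ler_wpM2l //.
  by rewrite addrC ler_normD.
pose w x := expR (- k * x - k ^+ 2 / 2).
have iw2 : gam.-integrable setT (EFin \o (fun x => w x ^+ 2)).
  have := integrableZl measurableT (expR (- k ^+ 2)) (integrable_expR (- 2 * k)).
  apply: eq_integrable => // x _ /=; rewrite -EFinM -expRD /w -expRM_natl.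
  by congr (_%:E); congr expR; field.
have Ew2 : \int[gam]_x (w x ^+ 2) = expR (k ^+ 2).
  rewrite (_ : (\int[gam]_x (w x ^+ 2)) = \int[gam]_x (expR (- k ^+ 2) * expR (- 2 * k * x))); last first.
    by apply: eq_Rintegral => x _; rewrite /w -expRM_natl -expRD; congr expR; field.
  rewrite RintegralZl //; last exact: integrable_expR.
  by rewrite /Rintegral integral_expR /= -expRD; congr expR; field.
set B := \int[gam]_x f x; set A := \int[gam]_x _.
have B0 : 0 <= B by apply: Rintegral_ge0 => x _.
have A0 : 0 <= A by apply: Rintegral_ge0 => x _; rewrite sqr_ge0.
(* Young's inequality with a free parameter [s] takes the place of Cauchy-Schwarz. *)
have key (s : R) : 0 < s -> B <= s / 2 * A + expR (k ^+ 2) / (2 * s).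
  move=> s0.
  have BE : B = \int[gam]_x (f (x + k) * w x).
    by rewrite /B /Rintegral (ge0_integral_gauss_shift _ k).
  have iR : gam.-integrable setT (EFin \o (fun x => s / 2 * f (x + k) ^+ 2 + (2 * s)^-1 * w x ^+ 2)).
    have := integrableD measurableT (integrableZl measurableT (s / 2) i2) (integrableZl measurableT (2 * s)^-1 iw2).
    by apply: eq_integrable => // x _ /=.
  have pw x : f (x + k) * w x <= s / 2 * f (x + k) ^+ 2 + (2 * s)^-1 * w x ^+ 2.
    have s0' : s != 0 by rewrite gt_eqF.
    rewrite -subr_ge0.
    have -> : s / 2 * f (x + k) ^+ 2 + (2 * s)^-1 * w x ^+ 2 - f (x + k) * w x =
       (2 * s)^-1 * (s * f (x + k) - w x) ^+ 2 by field.
    by rewrite mulr_ge0 ?sqr_ge0 // invr_ge0 mulr_ge0 // ltW.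
  have iL : gam.-integrable setT (EFin \o (fun x => f (x + k) * w x)).
    apply: (le_integrable _ _ _ iR) => //=.
      apply/measurable_EFinP; apply: continuous_measurable_fun => x.
      exact: (cvgM (cfk x) (clin x)).
    move=> x _; rewrite lee_fin ger0_norm ?mulr_ge0 ?expR_ge0 //.
    by apply: (le_trans (pw x)); exact: ler_norm.
  rewrite BE; apply: (@le_trans _ _ (\int[gam]_x (s / 2 * f (x + k) ^+ 2 + (2 * s)^-1 * w x ^+ 2))).
    by apply: le_Rintegral.
  rewrite RintegralD //; last 2 first.
  - by have := (integrableZl measurableT (s / 2) i2); apply: eq_integrable.
  - by have := (integrableZl measurableT (2 * s)^-1 iw2); apply: eq_integrable.
  by rewrite !RintegralZl // Ew2 lerD2l mulrC.
have [->|Bn0] := eqVneq B 0.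
  by rewrite expr0n /= mulr_ge0 ?expR_ge0.
have Bp : 0 < B by rewrite lt_def Bn0.
(* This [s] turns the second term into [B / 2], which moves to the left. *)
have := key (expR (k ^+ 2) / B) (divr_gt0 (expR_gt0 _) Bp).
have En0 : expR (k ^+ 2) != 0 by rewrite gt_eqF ?expR_gt0.
have -> : expR (k ^+ 2) / (2 * (expR (k ^+ 2) / B)) = B / 2 by field; rewrite En0 Bn0.
have -> : expR (k ^+ 2) / B / 2 * A = (expR (k ^+ 2) * A) / B / 2 by field.
move=> h; have : B <= (expR (k ^+ 2) * A) / B by lra.
by rewrite ler_pdivlMr // expr2.
Qed.

End Shift.

(** * Monotone functions and primitives of positive densities *)

Section Monotone.
Context {R : realType}.

Lemma is_derive_homo_le (f df : R -> R) (x y : R) :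
  (forall t : R, is_derive t (1 : R) f (df t)) -> (forall t, 0 <= df t) ->
  x <= y -> f x <= f y.
Proof.
move=> fd df0; rewrite le_eqVlt => /predU1P[->//|xy].
have [|c _ e] := @MVT R f df x y xy (fun t _ => fd t).
  by apply: derivable_within_continuous => t _; apply: ex_derive.
by rewrite -subr_ge0 e mulr_ge0 // subr_ge0 ltW.
Qed.

Lemma is_derive_homo_lt (f df : R -> R) (x y : R) :
  (forall t : R, is_derive t (1 : R) f (df t)) -> (forall t, 0 < df t) ->
  x < y -> f x < f y.
Proof.
move=> fd df0 xy.
have [|c _ e] := @MVT R f df x y xy (fun t _ => fd t).
  by apply: derivable_within_continuous => t _; apply: ex_derive.
by rewrite -subr_gt0 e mulr_gt0 // subr_gt0.
Qed.

End Monotone.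

Section Primitive.
Context {R : realType}.
Local Notation mu := (@lebesgue_measure R).
Variable u : R -> R.
Hypothesis cu : continuous u.
Hypothesis u0 : forall x, 0 < u x.
Hypothesis iu : mu.-integrable setT (EFin \o u).

Definition primitive (x : R) : R := \int[mu]_(t in `]-oo, x]) u t.
Local Notation I := (\int[mu]_t u t).

Lemma is_derive_primitive (x : R) : is_derive x (1 : R) primitive (u x).
Proof.
have [] := @continuous_FTC1 R u -oo%O x (x + 1) _ _ _ (@cu x).
- by rewrite ltrDl.
- exact: integrableS iu.
- by rewrite ltNyr.
by move=> dU Ux; apply: DeriveDef => //; rewrite -derive1E.
Qed.

Lemma primitive_lt x y : x < y -> primitive x < primitive y.
Proof. by apply: is_derive_homo_lt => // t; exact: is_derive_primitive. Qed.

Lemma primitive_inj x y : primitive x = primitive y -> x = y.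
Proof.
by move=> e; apply/eqP; case: ltgtP => // /primitive_lt; rewrite e ltxx.
Qed.

Lemma Rintegral_primitive_fin (A : set R) : measurable A ->
  (\int[mu]_(t in A) (u t)%:E)%E = (\int[mu]_(t in A) u t)%:E.
Proof.
move=> mA; rewrite /Rintegral fineK //.
by apply: integrable_fin_num => //; exact: integrableS iu.
Qed.

Lemma primitive_ge0 x : 0 <= primitive x.
Proof. by apply: Rintegral_ge0 => t _; apply: ltW. Qed.

Lemma primitive_gt0 x : 0 < primitive x.
Proof.
apply: (le_lt_trans (primitive_ge0 (x - 1))); apply: primitive_lt; lra.
Qed.

Lemma primitive_le x : primitive x <= I.
Proof.
rewrite -lee_fin -!Rintegral_primitive_fin //.
apply: ge0_subset_integral => //.
- by apply/measurable_EFinP; exact: continuous_measurable_fun.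
- by move=> t _; rewrite lee_fin ltW.
Qed.

Lemma primitive_ltI x : primitive x < I.
Proof.
apply: (lt_le_trans _ (primitive_le (x + 1))); apply: primitive_lt; lra.
Qed.

Lemma primitive_cvg_right (e : R) : 0 < e -> exists x, I - e < primitive x.
Proof.
move=> e0.
have := @ge0_nondecreasing_set_cvg_integral _ (measurableTypeR R) R (fun n : nat => `]-oo, (n%:R : R)]%classic) (EFin \o u) mu.
have -> : \bigcup_i `]-oo, (i%:R : R)]%classic = [set: R].
  apply/seteqP; split => // x _; exists (Num.truncn `|x|).+1 => //=.
  rewrite in_itv /=; apply: (le_trans (ler_norm x)); apply: ltW.
  by have /andP[] := truncn_itv (normr_ge0 x).
move=> h.
have {}h : ((\int[mu]_(x in `]-oo, (i%:R : R)]) (u x)%:E)%E @[i --> \oo] --> (\int[mu]_x (u x)%:E)%E).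
  apply: h => //.
  - move=> n m nm; apply/subsetPset => x /=; rewrite !in_itv /= => /le_trans; apply.
    by rewrite ler_nat.
  - move=> i; apply: measurable_funTS.
    by apply/measurable_EFinP; exact: continuous_measurable_fun.
  - by move=> i x _; rewrite lee_fin ltW.
rewrite Rintegral_primitive_fin // in h.
have {}h : (primitive i%:R @[i --> \oo] --> I).
  move/fine_cvgP: h => [_]; rewrite /= => h.
  by apply: cvg_trans h; apply: near_eq_cvg; near=> i => //=.
have /(_ _ e e0) := @cvgr_dist_lt _ R^o _ _ _ _ _ h.
move=> [n _ /(_ n (leqnn n))] /= hn; exists n%:R.
rewrite ger0_norm ?subr_ge0 ?primitive_le // in hn; lra.
Unshelve. all: by end_near. Qed.

Lemma primitive_cvg_left (e : R) : 0 < e -> exists x, primitive x < e.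
Proof.
move=> e0.
have := @ge0_nondecreasing_set_cvg_integral _ (measurableTypeR R) R (fun n : nat => `](- n%:R : R)%R, +oo[%classic) (EFin \o u) mu.
have -> : \bigcup_i `](- i%:R : R)%R, +oo[%classic = [set: R].
  apply/seteqP; split => // x _; exists (Num.truncn `|x|).+1 => //=.
  rewrite in_itv /= andbT ltrNl; apply: (le_lt_trans (ler_norm (- x))).
  by rewrite normrN; have /andP[] := truncn_itv (normr_ge0 x).
move=> h.
have {}h : ((\int[mu]_(x in `](- i%:R : R)%R, +oo[) (u x)%:E)%E @[i --> \oo] --> (\int[mu]_x (u x)%:E)%E).
  apply: h => //.
  - move=> n m nm; apply/subsetPset => x /=; rewrite !in_itv /= !andbT; apply: le_lt_trans.
    by rewrite lerN2 ler_nat.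
  - move=> i; apply: measurable_funTS.
    by apply/measurable_EFinP; exact: continuous_measurable_fun.
  - by move=> i x _; rewrite lee_fin ltW.
rewrite Rintegral_primitive_fin // in h.
have {}h : ((\int[mu]_(x in `](- i%:R : R)%R, +oo[) u x) @[i --> \oo] --> I).
  move/fine_cvgP: h => [_]; rewrite /= => h.
  by apply: cvg_trans h; apply: near_eq_cvg; near=> i => //=.
have /(_ _ e e0) := @cvgr_dist_lt _ R^o _ _ _ _ _ h.
move=> [n _ /(_ n (leqnn n))] /= hn; exists (- n%:R).
(* The mass right of [- n] is within [e] of the total, so the mass left of it is below [e]. *)
have e1 : I = primitive (- n%:R) + \int[mu]_(x in `](- n%:R : R)%R, +oo[) u x.
  rewrite /primitive -Rintegral_setU //.
  - by congr Rintegral; rewrite -(setUv `]-oo, (- n%:R : R)]%classic) setCitvl.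
  - by apply: integrableS iu => //; exact: measurableU.
  - by rewrite -setCitvl; exact/disj_setPCl.
rewrite e1 addrK ger0_norm ?primitive_ge0 // in hn.
Unshelve. all: by end_near. Qed.

Lemma primitive_surj v : 0 < v -> v < I -> exists x, primitive x = v.
Proof.
move=> v0 vI.
have [x xv] := primitive_cvg_left v v0.
have [|y yv] := primitive_cvg_right (I - v); first by rewrite subr_gt0.
rewrite opprB addrC subrK in yv.
have xy : x <= y.
  rewrite leNgt; apply/negP => /primitive_lt yx.
  by have := lt_trans (lt_trans yx xv) yv; rewrite ltxx.
have [||c _ <-] := @IVT R primitive x y v xy; last by exists c.
- apply: derivable_within_continuous => t _; by case: (is_derive_primitive t).
- have pxy : primitive x <= primitive y by apply: ltW; apply: lt_trans yv.
  by rewrite min_l // max_r // !ltW.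
Qed.

Lemma primitive_continuous : continuous primitive.
Proof.
move=> x; apply: differentiable_continuous; apply/derivable1_diffP.
by case: (is_derive_primitive x).
Qed.

End Primitive.

(** * The one-dimensional Gaussian Prekopa-Leindler inequality *)

Section PrekopaLeindler.
Context {R : realType}.
Local Notation mu := (@lebesgue_measure R).
Local Notation gam := (@normal_prob R 0 1).
Local Notation pdf := (@normal_pdf R 0 1).

Lemma integrable_pdf_mul (f : R -> R) : continuous f -> (forall x, 0 <= f x) ->
  gam.-integrable setT (EFin \o f) ->
  mu.-integrable setT (EFin \o (fun x => f x * pdf x)) /\
  \int[mu]_x (f x * pdf x) = \int[gam]_x f x.
Proof.
move=> cf f0 fi.
have mf : measurable_fun setT f by exact: continuous_measurable_fun.
have e := ge0_integral_gauss f mf f0.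
split; last by rewrite /Rintegral e.
apply/integrableP; split.
  by apply/measurable_EFinP; apply: measurable_funM => //; exact: measurable_normal_pdf.
under eq_integral do rewrite /= ger0_norm ?mulr_ge0 ?normal_pdf_ge0 //.
rewrite -e; have /integrableP[_] := fi.
by under eq_integral do rewrite /= ger0_norm //.
Qed.

Lemma increment_le1 (p q r s : R) : 0 <= p -> q <= 1 -> p - r <= q - s -> s - r <= 1.
Proof. lra. Qed.

Lemma increment_ge (A e x y : R) : A - e < x -> y < e -> A <= x - y + 2 * e.
Proof. lra. Qed.

(** With [q = r * u / v], the left side is the root of [u * v * q], at most [p] times the root of
    [q], which is at most [(1 + q) / 2]. *)
Lemma am_gm_transport (p r u v : R) : 0 <= p -> 0 < r -> 0 < u -> 0 < v ->
  u * v <= p ^+ 2 -> Num.sqrt r * u <= p * (2^-1 * (1 + v^-1 * (r * u))).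
Proof.
move=> p0 r0 u0 v0 uv; set q := v^-1 * (r * u).
have q0 : 0 < q by rewrite mulr_gt0 ?invr_gt0 // mulr_gt0.
rewrite -ler_sqr ?nnegrE; last 2 first.
- by rewrite mulr_ge0 ?sqrtr_ge0 // ltW.
- by apply: mulr_ge0 => //; apply: mulr_ge0; lra.
rewrite !exprMn (sqr_sqrtr (ltW r0)).
have qE : r * u = q * v by rewrite /q [RHS]mulrAC mulVf ?mul1r // gt_eqF.
apply: (@le_trans _ _ (u * v * (2^-1 ^+ 2 * (1 + q) ^+ 2))); last first.
  by rewrite ler_wpM2r // mulr_ge0 ?sqr_ge0.
have -> : r * u ^+ 2 = (u * v) * q by rewrite expr2 mulrA qE; ring.
apply: ler_wpM2l; first by rewrite mulr_ge0 ?ltW.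
have := sqr_ge0 (1 - q); nra.
Qed.

(* With U and V the primitives of exp(a) and exp(b) against the normal density and T the monotone
   map transporting U to a multiple of V, the normal distribution function at (x + T x) / 2 grows
   at least as fast as a multiple of U, by the arithmetic-geometric mean inequality. *)
Lemma prekopa_leindler_gauss (a b : R -> R) : continuous a -> continuous b ->
  gam.-integrable setT (EFin \o (fun x => expR (a x))) ->
  gam.-integrable setT (EFin \o (fun x => expR (b x))) ->
  (forall x y, a x + b y <= (x - y) ^+ 2 / 4) ->
  (\int[gam]_x expR (a x)) * (\int[gam]_x expR (b x)) <= 1.
Proof.
move=> ca cb ia ib ab.
have cea : continuous (fun x => expR (a x)).
  by move=> x; apply: continuous_comp; [exact: ca|exact: continuous_expR].
have ceb : continuous (fun x => expR (b x)).
  by move=> x; apply: continuous_comp; [exact: cb|exact: continuous_expR].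
have [iu Iu] := integrable_pdf_mul _ cea (fun x => expR_ge0 _) ia.
have [iv Iv] := integrable_pdf_mul _ ceb (fun x => expR_ge0 _) ib.
pose u x := expR (a x) * pdf x; pose v x := expR (b x) * pdf x.
have cu : continuous u by move=> x; exact: (cvgM (cea x) (continuous_pdf x)).
have cv : continuous v by move=> x; exact: (cvgM (ceb x) (continuous_pdf x)).
have u0 x : 0 < u x by rewrite mulr_gt0 ?expR_gt0 ?pdf_gt0.
have v0 x : 0 < v x by rewrite mulr_gt0 ?expR_gt0 ?pdf_gt0.
rewrite -Iu -Iv -[X in X * _]/(\int[mu]_x u x) -[X in _ * X]/(\int[mu]_x v x).
set A := \int[mu]_x u x; set B := \int[mu]_x v x.
pose U := primitive u; pose V := primitive v; pose N := primitive pdf.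
have iN := @integrable_normal_pdf R 0 1.
have N1 : \int[mu]_x pdf x = 1 by rewrite /Rintegral integral_normal_pdf.
have dU (x : R) : is_derive x (1:R) U (u x) by exact: is_derive_primitive.
have dV (x : R) : is_derive x (1:R) V (v x) by exact: is_derive_primitive.
have dN (x : R) : is_derive x (1:R) N (pdf x).
  by apply: is_derive_primitive => //; exact: continuous_pdf.
have U0 x : 0 < U x by exact: primitive_gt0.
have UA x : U x < A by exact: primitive_ltI.
have A0 : 0 < A by apply: lt_trans (UA 0).
have B0 : 0 < B by apply: (lt_trans (primitive_gt0 _ cv v0 iv 0)); exact: primitive_ltI.
(* The ratio of the masses: [r * U] then stays within the range of [V], and [(Num.sqrt r * A) ^+ 2]
   is [A * B]. *)
pose r := B / A; have r0 : 0 < r by rewrite divr_gt0.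
(* [Vinv] matters only on values of [V], where the default [0] plays no part. *)
pose Vinv p := xget 0 [set y | V y = p].
have VK : cancel V Vinv.
  move=> y; apply: (@primitive_inj _ v) => //.
  by have := @xgetPex _ (0:R) [set y' | V y' = V y] (ex_intro _ y erefl).
pose T x := Vinv (r * U x).
have VT x : V (T x) = r * U x.
  apply: (@xgetPex _ (0:R) [set y' | V y' = r * U x]).
  apply: primitive_surj => //; first by rewrite mulr_gt0.
  by rewrite /r mulrAC ltr_pdivrMr // ltr_pM2l.
have dT (x : R) : is_derive x (1:R) T ((v (T x))^-1 * (r * u x)).
  apply: (@is_derive1_comp _ Vinv (fun x => r * U x)).
    rewrite -VT; apply: (@is_derive_inverse R V Vinv (v (T x)) (T x)).
    - by near=> z; exact: VK.
    - near=> z; exact: primitive_continuous.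
    - by rewrite gt_eqF.
pose z x := 2^-1 * (x + T x).
have dz (x : R) : is_derive x (1:R) z (2^-1 * (1 + (v (T x))^-1 * (r * u x))).
  exact: (is_deriveZ 2^-1 (is_deriveD (is_derive_id x (1:R)) (dT x))).
pose H x := N (z x) - Num.sqrt r * U x.
have dH (x : R) : is_derive x (1:R) H (pdf (z x) * (2^-1 * (1 + (v (T x))^-1 * (r * u x))) - Num.sqrt r * u x).
  exact: (is_deriveB (is_derive1_comp (dN (z x)) (dz x)) (is_deriveZ (Num.sqrt r) (dU x))).
have dH0 (x : R) : 0 <= pdf (z x) * (2^-1 * (1 + (v (T x))^-1 * (r * u x))) - Num.sqrt r * u x.
  rewrite subr_ge0; apply: am_gm_transport => //; first exact/ltW/pdf_gt0.
  (* The quadratic terms combine: [(x - y)^2 / 4 - x^2 / 2 - y^2 / 2] is [- ((x + y) / 2)^2], the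
     exponent of the squared density at the midpoint. *)
  rewrite /u /v !pdfE exprMn.
  set s := normal_peak 1.
  have -> : expR (a x) * (s * expR (- x ^+ 2 / 2)) * (expR (b (T x)) * (s * expR (- T x ^+ 2 / 2))) =
    s ^+ 2 * expR (a x + b (T x) + (- x ^+ 2 / 2 + (- T x ^+ 2 / 2))).
    by rewrite !expRD; ring.
  rewrite ler_wpM2l ?sqr_ge0 // -expRM_natl ler_expR.
  have := ab x (T x); rewrite /z; nra.
(* [N] takes values in [0, 1], so every finite increment is bounded; the limits at infinity are then
   approached up to [e]. *)
have fin (x y : R) : y <= x -> Num.sqrt r * (U x - U y) <= 1.
  move=> yx; rewrite mulrBr; apply: (@increment_le1 (N (z y)) (N (z x))).
  - by apply: primitive_ge0 => //; exact: pdf_gt0.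
  - by rewrite -N1; apply: primitive_le => //; [exact: continuous_pdf|exact: pdf_gt0].
  - exact: (is_derive_homo_le H _ y x dH dH0 yx).
have sr0 : 0 < Num.sqrt r by rewrite sqrtr_gt0.
have : Num.sqrt r * A <= 1.
  apply/ler_addgt0Pr => e e0.
  have e2 : 0 < e / (2 * Num.sqrt r) by rewrite divr_gt0 // mulr_gt0.
  have [y hy] := primitive_cvg_left u cu u0 iu _ e2.
  have [x hx] := primitive_cvg_right u cu u0 iu _ e2.
  have h1 : Num.sqrt r * (U x - U y) <= 1.
    case: (leP y x) => [/fin //|xy].
    have : U x < U y by exact: primitive_lt.
    move=> h; apply: (@le_trans _ _ 0) => //; apply: mulr_ge0_le0; first exact: ltW.
    by rewrite subr_le0 ltW.
  have : Num.sqrt r * A <= Num.sqrt r * (U x - U y + 2 * (e / (2 * Num.sqrt r))).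
    by rewrite ler_pM2l //; exact: increment_ge.
  move=> /le_trans; apply; rewrite mulrDr.
  have -> : Num.sqrt r * (2 * (e / (2 * Num.sqrt r))) = e by field; rewrite gt_eqF.
  by rewrite lerD2r.
move=> h; have : (Num.sqrt r * A) ^+ 2 <= 1.
  by rewrite -[leRHS](expr1n _ 2) ler_sqr ?nnegrE ?ler01 // mulr_ge0 ?ltW.
rewrite exprMn (sqr_sqrtr (ltW r0)) /r.
by have -> : B / A * A ^+ 2 = A * B by field; rewrite gt_eqF.
Unshelve. all: by end_near. Qed.

End PrekopaLeindler.

(** * Iterated Gaussian expectation *)

Section Tame.
Context {R : realType}.

Definition norm1 n (x : 'rV[R]_n) : R := \sum_(i < n) `|x ord0 i|.

Lemma norm1_ge0 n (x : 'rV[R]_n) : 0 <= norm1 n x.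
Proof. by apply: sumr_ge0 => i _. Qed.

Lemma norm1D n (x y : 'rV[R]_n) : norm1 n (x + y) <= norm1 n x + norm1 n y.
Proof.
by rewrite /norm1 -big_split /=; apply: ler_sum => i _; rewrite mxE ler_normD.
Qed.

Lemma norm1N n (x : 'rV[R]_n) : norm1 n (- x) = norm1 n x.
Proof. by apply: eq_bigr => i _; rewrite mxE normrN. Qed.

Lemma norm1_0 n : norm1 n 0 = 0.
Proof. by rewrite /norm1 big1 // => i _; rewrite mxE normr0. Qed.

(* This class is closed under products, contains the exponentials of Lipschitz functions, and is
   preserved by integrating out one coordinate, all without using the topology of ['rV[R]_n]. *)
Definition tame n (f : 'rV[R]_n -> R) := exists C L : R, 0 <= C /\ 0 <= L /\
  forall x y, `|f x - f y| <= C * expR (L * (norm1 n x + norm1 n y)) * norm1 n (x - y).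

Definition lip1 n (L : R) (f : 'rV[R]_n -> R) :=
  forall x y, `|f x - f y| <= L * norm1 n (x - y).

Lemma tame_lip1 n L f : 0 <= L -> lip1 n L f -> tame n f.
Proof.
move=> L0 fL; exists L, 0; split => //; split => // x y.
by rewrite mul0r expR0 mulr1.
Qed.

Lemma tame_cst n (c : R) : tame n (fun=> c).
Proof. by apply: (@tame_lip1 _ 0) => // x y; rewrite subrr normr0 mul0r. Qed.

Lemma le_expR_norm1 n (C C' L L' : R) (x y : 'rV[R]_n) : 0 <= C -> C <= C' -> L <= L' ->
  C * expR (L * (norm1 n x + norm1 n y)) <= C' * expR (L' * (norm1 n x + norm1 n y)).
Proof.
move=> C0 CC LL; apply: ler_pM => //.
by rewrite ler_expR ler_wpM2r // addr_ge0 // norm1_ge0.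
Qed.

Lemma tameD n f g : tame n f -> tame n g -> tame n (fun x => f x + g x).
Proof.
move=> [C [L [C0 [L0 fL]]]] [D [M [D0 [M0 gM]]]].
exists (C + D), (L + M); split; first by rewrite addr_ge0.
split=> [|x y]; first by rewrite addr_ge0.
have -> : f x + g x - (f y + g y) = (f x - f y) + (g x - g y) by ring.
apply: (le_trans (ler_normD _ _)); rewrite [X in _ <= X * _]mulrDl mulrDl; apply: lerD.
  apply: (le_trans (fL x y)); rewrite ler_wpM2r ?norm1_ge0 //; apply: le_expR_norm1 => //; lra.
apply: (le_trans (gM x y)); rewrite ler_wpM2r ?norm1_ge0 //; apply: le_expR_norm1 => //; lra.
Qed.

Lemma tameZ n (k : R) f : tame n f -> tame n (fun x => k * f x).
Proof.
move=> [C [L [C0 [L0 fL]]]]; exists (`|k| * C), L; split; first by rewrite mulr_ge0.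
split=> // x y; rewrite -mulrBr normrM -!mulrA; apply: ler_wpM2l => //.
by rewrite mulrA.
Qed.

Lemma tameB n f g : tame n f -> tame n g -> tame n (fun x => f x - g x).
Proof.
move=> tf tg; rewrite (_ : (fun _ => _) = (fun x => f x + (-1) * g x)).
  by apply: tameD => //; exact: tameZ.
by apply/funext => x; rewrite mulN1r.
Qed.

Lemma tame_bound n f : tame n f -> exists C L : R, 0 <= C /\ 0 <= L /\
  forall x, `|f x| <= C * expR (L * norm1 n x).
Proof.
move=> [C [L [C0 [L0 fL]]]].
exists (`|f 0| + C), (L + 1); split; first by rewrite addr_ge0.
split; first by lra.
move=> x; have := fL x 0; rewrite subr0 norm1_0 addr0 => h.
have -> : f x = f 0 + (f x - f 0) by ring.
have x0 := norm1_ge0 n x.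
apply: (le_trans (ler_normD _ _)); rewrite mulrDl lerD //.
  by rewrite ler_peMr // -expR0 ler_expR mulr_ge0 // addr_ge0.
apply: (le_trans h); rewrite -mulrA ler_wpM2l // mulrDl mul1r expRD.
rewrite ler_wpM2l ?expR_ge0 //; have := expR_ge1Dx (norm1 n x); lra.
Qed.

Lemma tameM n f g : tame n f -> tame n g -> tame n (fun x => f x * g x).
Proof.
move=> tf tg; have [C1 [L1 [C10 [L10 fb]]]] := tame_bound _ _ tf.
have [C2 [L2 [C20 [L20 gb]]]] := tame_bound _ _ tg.
move: tf tg => [C [L [C0 [L0 fL]]]] [D [M [D0 [M0 gM]]]].
exists (C1 * D + C2 * C), (L1 + M + L2 + L); split; first by rewrite addr_ge0 // mulr_ge0.
split=> [|x y]; first by rewrite !addr_ge0.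
have -> : f x * g x - f y * g y = f x * (g x - g y) + g y * (f x - f y) by ring.
apply: (le_trans (ler_normD _ _)); rewrite [X in _ <= X * _]mulrDl mulrDl !normrM.
have x0 := norm1_ge0 n x; have y0 := norm1_ge0 n y.
apply: lerD.
- apply: (@le_trans _ _ ((C1 * expR (L1 * norm1 n x)) * (D * expR (M * (norm1 n x + norm1 n y)) * norm1 n (x - y)))).
    by apply: ler_pM.
  have -> : C1 * expR (L1 * norm1 n x) * (D * expR (M * (norm1 n x + norm1 n y)) * norm1 n (x - y)) =
    C1 * D * expR (L1 * norm1 n x + M * (norm1 n x + norm1 n y)) * norm1 n (x - y) by rewrite expRD; ring.
  rewrite ler_wpM2r ?norm1_ge0 // ler_wpM2l ?mulr_ge0 // ler_expR; nra.
- apply: (@le_trans _ _ ((C2 * expR (L2 * norm1 n y)) * (C * expR (L * (norm1 n x + norm1 n y)) * norm1 n (x - y)))).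
    by apply: ler_pM.
  have -> : C2 * expR (L2 * norm1 n y) * (C * expR (L * (norm1 n x + norm1 n y)) * norm1 n (x - y)) =
    C2 * C * expR (L2 * norm1 n y + L * (norm1 n x + norm1 n y)) * norm1 n (x - y) by rewrite expRD; ring.
  rewrite ler_wpM2r ?norm1_ge0 // ler_wpM2l ?mulr_ge0 // ler_expR; nra.
Qed.

Lemma tame_shift n f (k : 'rV[R]_n) : tame n f -> tame n (fun x => f (x + k)).
Proof.
move=> [C [L [C0 [L0 fL]]]].
exists (C * expR (L * (2 * norm1 n k))), L; split; first by rewrite mulr_ge0 ?expR_ge0.
split=> // x y; apply: (le_trans (fL _ _)).
have -> : x + k - (y + k) = x - y by rewrite opprD addrACA subrr addr0.
rewrite ler_wpM2r ?norm1_ge0 // -mulrA ler_wpM2l // -expRD ler_expR -mulrDr ler_wpM2l //.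
have := norm1D n x k; have := norm1D n y k; lra.
Qed.

(** The graph of [expR] lies above its tangent at the larger of the two points. *)
Lemma expR_lip (s t M : R) : s <= M -> t <= M -> `|expR s - expR t| <= expR M * `|s - t|.
Proof.
wlog ts : s t / t <= s => [h sM tM|sM tM].
  by case: (leP t s) => [/h->//|/ltW /h]; rewrite distrC [`|s - t|]distrC => ->.
rewrite !ger0_norm ?subr_ge0 ?ler_expR //.
have h : expR t >= expR s * (1 + (t - s)).
  by rewrite -[X in _ <= expR X](subrKC s) expRD ler_wpM2l ?expR_ge0 // expR_ge1Dx.
apply: (@le_trans _ _ (expR s * (s - t))); first by lra.
by rewrite ler_wpM2r ?subr_ge0 // ler_expR.
Qed.

Lemma tame_expR n L f : 0 <= L -> lip1 n L f -> tame n (fun x => expR (f x)).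
Proof.
move=> L0 fL; exists (expR `|f 0| * L), L; split; first by rewrite mulr_ge0 ?expR_ge0.
split=> // x y.
have x0 := norm1_ge0 n x; have y0 := norm1_ge0 n y.
have fb z : f z <= `|f 0| + L * norm1 n z.
  have := fL z 0; rewrite subr0 => h; have := ler_norm (f z - f 0); have := ler_norm (f 0); lra.
have := @expR_lip (f x) (f y) (`|f 0| + L * (norm1 n x + norm1 n y)).
move=> h; apply: (le_trans (h _ _)).
- have := fb x; nra.
- have := fb y; nra.
rewrite expRD [X in _ <= X * _]mulrAC -[leRHS]mulrA ler_wpM2l ?mulr_ge0 ?expR_ge0 //.
Qed.

(** The same term as in the recursion of [gauss_exp], so that slices match it by conversion. *)
Definition cons n (a : R) (v : 'rV[R]_n) : 'rV[R]_n.+1 := row_mx (a%:M : 'rV[R]_1) v.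

Lemma cons0 n a (v : 'rV[R]_n) : cons n a v ord0 ord0 = a.
Proof.
rewrite /cons (_ : ord0 = lshift n (ord0 : 'I_1)); last exact: val_inj.
by rewrite (@row_mxEl _ 1 1 n) mxE eqxx mulr1n.
Qed.

Lemma consS n a (v : 'rV[R]_n) i : cons n a v ord0 (lift ord0 i) = v ord0 i.
Proof.
rewrite /cons (_ : lift ord0 i = rshift 1 i); last exact: val_inj.
by rewrite (@row_mxEr _ 1 1 n).
Qed.

Lemma cons_ex n (x : 'rV[R]_n.+1) : exists a v, x = cons n a v.
Proof.
exists (x ord0 ord0), (\row_i x ord0 (lift ord0 i)); apply/rowP => i.
case: (unliftP ord0 i) => [j|] ->; last by rewrite cons0.
by rewrite consS mxE.
Qed.

Lemma consD n a b (v w : 'rV[R]_n) : cons n a v + cons n b w = cons n (a + b) (v + w).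
Proof.
apply/rowP => i; rewrite mxE.
by case: (unliftP ord0 i) => [j|] ->; [rewrite !consS mxE|rewrite !cons0].
Qed.

Lemma consB n a b (v w : 'rV[R]_n) : cons n a v - cons n b w = cons n (a - b) (v - w).
Proof.
apply/rowP => i; rewrite [LHS]mxE [X in _ + X]mxE.
by case: (unliftP ord0 i) => [j|] ->; [rewrite !consS !mxE|rewrite !cons0].
Qed.

Lemma norm1_cons n a (v : 'rV[R]_n) : norm1 n.+1 (cons n a v) = `|a| + norm1 n v.
Proof.
rewrite /norm1 big_ord_recl cons0; congr (_ + _).
by apply: eq_bigr => i _; rewrite consS.
Qed.

Lemma dotv_cons n a b (v w : 'rV[R]_n) : dotv (cons n a v) (cons n b w) = a * b + dotv v w.
Proof.
rewrite /dotv big_ord_recl !cons0; congr (_ + _).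
by apply: eq_bigr => i _; rewrite !consS.
Qed.

Lemma tame_slice n f a : tame n.+1 f -> tame n (fun v => f (cons n a v)).
Proof.
move=> [C [L [C0 [L0 fL]]]].
exists (C * expR (L * (2 * `|a|))), L; split; first by rewrite mulr_ge0 ?expR_ge0.
split=> // x y; apply: (le_trans (fL _ _)).
rewrite consB subrr !norm1_cons normr0 add0r ler_wpM2r ?norm1_ge0 //.
rewrite -mulrA -expRD ler_wpM2l // ler_expR; lra.
Qed.

Lemma lip1_slice n L f a : lip1 n.+1 L f -> lip1 n L (fun v => f (cons n a v)).
Proof.
by move=> fL x y; apply: (le_trans (fL _ _)); rewrite consB subrr norm1_cons normr0 add0r.
Qed.

Lemma lip1_norm1 n (L : R) : 0 <= L -> lip1 n L (fun x => L * norm1 n x).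
Proof.
move=> L0 x y; rewrite -mulrBr normrM ger0_norm // ler_wpM2l //.
rewrite ler_norml; apply/andP; split.
  by rewrite lerNl opprB lerBlDr -[norm1 n (x - y)]norm1N opprB -{1}(subrK x y) norm1D.
by rewrite lerBlDr -{1}(subrK y x) norm1D.
Qed.

End Tame.

(** * Finiteness, linearity and monotonicity of the iterated expectation *)

Section GaussExp.
Context {R : realType}.
Local Notation gam := (@normal_prob R 0 1).

Definition gE n (f : 'rV[R]_n -> R) : R := fine (gauss_exp f).

(** The four properties go through one induction: finiteness in dimension [n.+1] rests on
    integrability of the slice expectations, whose growth bound uses all the others in dimension
    [n]. *)
Definition gE_spec n := [/\
  forall f, tame n f -> gauss_exp f = (gE n f)%:E,
  forall f g (k : R), tame n f -> tame n g ->
    gE n (fun x => k * f x + g x) = k * gE n f + gE n g,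
  forall f g, tame n f -> tame n g -> (forall x, f x <= g x) -> gE n f <= gE n g &
  forall c : R, gE n (fun=> c) = c].

(** Changing the first coordinate from [b] to [a] changes [f] by at most a factor depending on [a]
    and [b] times the weight [E v], whose expectation is a constant. *)
Lemma expgrowth_slice n f : gE_spec n -> tame n.+1 f ->
  expgrowth (fun a => gE n (fun v => f (cons n a v))).
Proof.
move=> [fin lin mon cst] tf; have sl a := tame_slice n f a tf.
move: tf => [C [L [C0 [L0 fL]]]].
have L20 : 0 <= 2 * L by rewrite mulr_ge0.
pose E v := expR (2 * L * norm1 n v).
have tE : tame n E by apply: (tame_expR _ (2 * L)) => //; exact: lip1_norm1.
have E0 : 0 <= gE n E.
  by rewrite -(cst 0); apply: mon => // [|x]; [exact: tame_cst|exact: expR_ge0].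
exists (C * gE n E), L; split; first by rewrite mulr_ge0.
split => //.
have key a b : gE n (fun v => f (cons n a v)) <= C * gE n E * expR (L * (`|a| + `|b|)) * `|a - b| + gE n (fun v => f (cons n b v)).
  have -> : C * gE n E * expR (L * (`|a| + `|b|)) * `|a - b| =
    C * expR (L * (`|a| + `|b|)) * `|a - b| * gE n E by ring.
  rewrite -lin //.
  apply: mon => // [|v]; first by apply: tameD => //; exact: tameZ.
  rewrite -lerBlDr; apply: (le_trans (ler_norm _)); apply: (le_trans (fL _ _)).
  rewrite consB subrr !norm1_cons norm1_0 addr0 /E.
  rewrite [leRHS]mulrAC ler_wpM2r // -[leRHS]mulrA -expRD ler_wpM2l // ler_expR; lra.
move=> a b; rewrite ler_norml; apply/andP; split.
  by rewrite lerNl opprB lerBlDr distrC [`|a| + _]addrC.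
by rewrite lerBlDr.
Qed.

Lemma gauss_expS n f : gE_spec n -> tame n.+1 f ->
  gauss_exp f = (\int[gam]_a (gE n (fun v => f (cons n a v))))%:E.
Proof.
move=> sp tf; have [fin _ _ _] := sp.
rewrite /= /Rintegral fineK; last first.
  by apply: integrable_fin_num => //; apply: integrable_expgrowth; exact: expgrowth_slice.
by apply: eq_integral => a _; rewrite -fin //; exact: tame_slice.
Qed.

Lemma gE_specP n : gE_spec n.
Proof.
elim: n => [|n IH].
  by split => // f g _ _; exact.
have [fin lin mon cst] := IH.
have ES f : tame n.+1 f -> gE n.+1 f = \int[gam]_a (gE n (fun v => f (cons n a v))).
  by move=> tf; rewrite {1}/gE gauss_expS.
have ig f : tame n.+1 f -> gam.-integrable setT (EFin \o (fun a => gE n (fun v => f (cons n a v)))).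
  by move=> tf; apply: integrable_expgrowth; exact: expgrowth_slice.
split.
- by move=> f tf; rewrite /gE gauss_expS.
- move=> f g k tf tg; rewrite !ES //; last by apply: tameD => //; exact: tameZ.
  rewrite -RintegralZl //; last exact: ig.
  rewrite -RintegralD //; last 2 first.
  + by have := integrableZl measurableT k (ig f tf); apply: eq_integrable.
  + exact: ig.
  by apply: eq_Rintegral => a _; rewrite lin //; exact: tame_slice.
- move=> f g tf tg fg; rewrite !ES //; apply: le_Rintegral => //; try exact: ig.
  by move=> a _; apply: mon => //; exact: tame_slice.
- move=> c; rewrite ES; last exact: tame_cst.
  under eq_Rintegral do rewrite cst.
  rewrite Rintegral_cst //; set m := fine _.
  have -> : m = 1 by rewrite /m [X in fine X](@probability_setT _ _ _ (normal_prob 0 1)).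
  by rewrite mulr1.
Qed.

Lemma gauss_expE n f : tame n f -> gauss_exp f = (gE n f)%:E.
Proof. by move=> tf; have [+ _ _ _] := gE_specP n; apply. Qed.

Lemma gES n f : tame n.+1 f -> gE n.+1 f = \int[gam]_a (gE n (fun v => f (cons n a v))).
Proof. by move=> tf; rewrite {1}/gE gauss_expS //; exact: gE_specP. Qed.

Lemma le_gE n f g : tame n f -> tame n g -> (forall x, f x <= g x) -> gE n f <= gE n g.
Proof. by move=> tf tg; have [_ _ + _] := gE_specP n; apply. Qed.

Lemma gE_cst n (c : R) : gE n (fun=> c) = c.
Proof. by have [_ _ _ ->] := gE_specP n. Qed.

Lemma gE_linear n f g (k : R) : tame n f -> tame n g ->
    gE n (fun x => k * f x + g x) = k * gE n f + gE n g.
Proof. by move=> tf tg; have [_ + _ _] := gE_specP n; apply. Qed.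

Lemma gEZ n f (k : R) : tame n f -> gE n (fun x => k * f x) = k * gE n f.
Proof.
move=> tf; rewrite -[RHS]addr0 -(gE_cst n 0) -gE_linear //; last exact: tame_cst.
by congr gE; apply/funext => x; rewrite addr0.
Qed.

Lemma gED n f g : tame n f -> tame n g -> gE n (fun x => f x + g x) = gE n f + gE n g.
Proof.
move=> tf tg; rewrite -[gE n f]mul1r -gE_linear //.
by congr gE; apply/funext => x; rewrite mul1r.
Qed.

Lemma gEB n f g : tame n f -> tame n g -> gE n (fun x => f x - g x) = gE n f - gE n g.
Proof.
move=> tf tg; rewrite addrC -mulN1r -gE_linear //.
by congr gE; apply/funext => x; rewrite mulN1r addrC.
Qed.

Lemma gE_ge0 n f : tame n f -> (forall x, 0 <= f x) -> 0 <= gE n f.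
Proof. by move=> tf f0; rewrite -(gE_cst n 0); apply: le_gE => //; exact: tame_cst. Qed.

End GaussExp.

(** * Gaussian concentration *)

Section Concentration.
Context {R : realType}.
Local Notation gam := (@normal_prob R 0 1).

(** Integrate the tangent of [expR] at the mean of [f], which lies below [expR]. *)
Lemma jensen_expR n f (L : R) : 0 <= L -> lip1 n L f ->
  expR (gE n f) <= gE n (fun x => expR (f x)).
Proof.
move=> L0 fL; have tf := tame_lip1 n L f L0 fL.
have te := tame_expR n L f L0 fL.
set m := gE n f.
have -> : expR m = gE n (fun x => expR m * (1 - m + f x)).
  rewrite gEZ; last by apply: tameD => //; exact: tame_cst.
  by rewrite gED //; [rewrite gE_cst subrK mulr1|exact: tame_cst].
apply: le_gE => // [|x].
  by apply: tameZ; apply: tameD => //; exact: tame_cst.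
rewrite -[X in _ <= expR X](subrKC m) expRD ler_wpM2l ?expR_ge0 //.
have := expR_ge1Dx (f x - m); lra.
Qed.

Lemma gE_expR_gt0 n f (L : R) : 0 <= L -> lip1 n L f -> 0 < gE n (fun x => expR (f x)).
Proof. by move=> L0 fL; apply: lt_le_trans (jensen_expR _ _ _ L0 fL); exact: expR_gt0. Qed.

Lemma lip1_subC n (L c : R) f : lip1 n L f -> lip1 n L (fun x => f x - c).
Proof. by move=> fL x y; rewrite opprB addrA subrK; exact: fL. Qed.

Lemma gE_expR_subC n f (L c : R) : 0 <= L -> lip1 n L f ->
  gE n (fun x => expR (f x - c)) = expR (- c) * gE n (fun x => expR (f x)).
Proof.
move=> L0 fL; rewrite -gEZ; last exact: (tame_expR _ L).
by congr gE; apply/funext => x; rewrite expRD mulrC.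
Qed.

(** Supplies the continuity that [prekopa_leindler_gauss] requires of the logarithms of the slice
    expectations. *)
Lemma ln_slice_lip n f (L : R) : 0 <= L -> lip1 n.+1 L f ->
  forall s t, `|ln (gE n (fun v => expR (f (cons n s v)))) -
                ln (gE n (fun v => expR (f (cons n t v))))| <= L * `|s - t|.
Proof.
move=> L0 fL; pose A s := gE n (fun v => expR (f (cons n s v))).
have sl s := lip1_slice n L f s fL.
have A0 s : 0 < A s by exact: (gE_expR_gt0 _ _ L).
have key s t : ln (A s) <= ln (A t) + L * `|s - t|.
  rewrite -[X in _ + X]expRK -lnM ?posrE ?expR_gt0 // ler_ln ?posrE ?mulr_gt0 ?expR_gt0 //.
  rewrite /A mulrC -gEZ; last exact: (tame_expR _ L).
  apply: le_gE => [|| v].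
  - exact: (tame_expR _ L).
  - by apply: tameZ; exact: (tame_expR _ L).
  - rewrite -expRD ler_expR -lerBlDr; apply: (le_trans (ler_norm _)).
    by apply: (le_trans (fL _ _)); rewrite consB subrr norm1_cons norm1_0 addr0.
move=> s t; rewrite ler_norml -!/(A _); apply/andP; split.
  by have := key t s; rewrite distrC; lra.
by have := key s t; lra.
Qed.

(* Maurey's property (tau): the hypothesis is additive over coordinates, so the
   one-dimensional inequality tensorizes. *)
Lemma property_tau n (a b : 'rV[R]_n -> R) (L : R) : 0 <= L ->
  lip1 n L a -> lip1 n L b ->
  (forall x y, a x + b y <= dotv (x - y) (x - y) / 4) ->
  gE n (fun x => expR (a x)) * gE n (fun x => expR (b x)) <= 1.
Proof.
move=> L0; elim: n a b => [|n IH] a b aL bL ab.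
  rewrite /gE /= -expRD -[X in _ <= X]expR0 ler_expR.
  by apply: (le_trans (ab 0 0)); rewrite subrr /dotv big_ord0 mul0r.
pose A s := gE n (fun v => expR (a (cons n s v))).
pose B s := gE n (fun v => expR (b (cons n s v))).
have asl s := lip1_slice n L a s aL; have bsl s := lip1_slice n L b s bL.
have A0 s : 0 < A s by exact: (gE_expR_gt0 _ _ L).
have B0 s : 0 < B s by exact: (gE_expR_gt0 _ _ L).
have ta := tame_expR n.+1 L a L0 aL; have tb := tame_expR n.+1 L b L0 bL.
rewrite !gES //.
have gA : expgrowth A by exact: (expgrowth_slice _ _ (gE_specP n) ta).
have gB : expgrowth B by exact: (expgrowth_slice _ _ (gE_specP n) tb).
have AE : A = (fun s => expR (ln (A s))) by apply/funext => s; rewrite lnK ?posrE.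
have BE : B = (fun s => expR (ln (B s))) by apply/funext => s; rewrite lnK ?posrE.
have iA := integrable_expgrowth _ gA; have iB := integrable_expgrowth _ gB.
have lc (f : R -> R) : (forall s t, `|f s - f t| <= L * `|s - t|) -> continuous f.
  move=> fL; apply: expgrowth_continuous; exists L, 0; split => //; split => // s t.
  by rewrite mul0r expR0 mulr1.
rewrite -[X in X * _]/(\int[gam]_s A s) -[X in _ * X]/(\int[gam]_s B s).
rewrite AE BE; apply: prekopa_leindler_gauss.
- by apply: lc; exact: ln_slice_lip.
- by apply: lc; exact: ln_slice_lip.
- by rewrite -AE.
- by rewrite -BE.
move=> s t; rewrite -lnM ?posrE // -[leRHS]expRK ler_ln ?posrE ?mulr_gt0 ?expR_gt0 //.
(* The first coordinate contributes [(s - t)^2 / 4] to the quadratic cost; subtracting it leaves the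
   hypothesis in dimension [n]. *)
have := IH (fun v => a (cons n s v) - (s - t) ^+ 2 / 4) (fun v => b (cons n t v)) (lip1_subC _ _ _ _ (asl s)) (bsl t).
rewrite (gE_expR_subC _ _ L) // -/(A s) -/(B t) => h.
have {}h : expR (- ((s - t) ^+ 2 / 4)) * A s * B t <= 1.
  by apply: h => v w; have := ab (cons n s v) (cons n t w); rewrite consB dotv_cons; lra.
by rewrite -mulrA expRN mulrC ler_pdivrMr ?expR_gt0 // mul1r in h.
Qed.

Lemma dotv_ge0 n (x : 'rV[R]_n) : 0 <= dotv x x.
Proof. by apply: sumr_ge0 => i _; rewrite -expr2 sqr_ge0. Qed.

Lemma enorm_ge0 n (x : 'rV[R]_n) : 0 <= enorm x.
Proof. exact: sqrtr_ge0. Qed.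

Lemma enorm_sqr n (x : 'rV[R]_n) : enorm x ^+ 2 = dotv x x.
Proof. by rewrite sqr_sqrtr // dotv_ge0. Qed.

Lemma enorm_le_norm1 n (x : 'rV[R]_n) : enorm x <= norm1 n x.
Proof.
rewrite -ler_sqr ?nnegrE ?enorm_ge0 ?norm1_ge0 // enorm_sqr expr2 /norm1 mulr_suml.
apply: ler_sum => i _; rewrite -expr2 -[leLHS]real_normK ?num_real // expr2 ler_wpM2l //.
by rewrite (bigD1 i) //= lerDl sumr_ge0.
Qed.

Definition lip2 n (L : R) (f : 'rV[R]_n -> R) :=
  forall x y, `|f x - f y| <= L * enorm (x - y).

Lemma lip2_lip1 n L f : 0 <= L -> lip2 n L f -> lip1 n L f.
Proof.
move=> L0 fL x y; apply: (le_trans (fL x y)).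
by rewrite ler_wpM2l // enorm_le_norm1.
Qed.

(** With [s = u / 2], the bracket is [(expR s - expR (- s)) ^+ 2], and for [s >= 0] the difference
    is at least [(1 + s) - 1]. *)
Lemma sqr_le_expRD (u : R) : u ^+ 2 <= 4 * (expR u + expR (- u) - 2).
Proof.
wlog u0 : u / 0 <= u.
  move=> h; case: (leP 0 u) => [/h //|un]; have := h (- u).
  by rewrite opprK sqrrN oppr_ge0 [expR (- u) + _]addrC; apply; exact: ltW.
pose s := u / 2; have s0 : 0 <= s by rewrite /s; lra.
have -> : u = s + s by rewrite /s; field.
have e1 : expR s * expR (- s) = 1 by exact: expRxMexpNx_1.
have -> : expR (s + s) + expR (- (s + s)) - 2 = (expR s - expR (- s)) ^+ 2.
  by rewrite opprD !expRD; ring: e1.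
have h1 := expR_ge1Dx s.
have h2 : expR (- s) <= 1 by rewrite expR_le1 oppr_le0.
have -> : (s + s) ^+ 2 = 4 * s ^+ 2 by ring.
rewrite ler_wpM2l // ler_sqr ?nnegrE //; lra.
Qed.

Lemma expR1_le4 : expR 1 <= 4 :> R.
Proof.
have e1 : expR 2^-1 * expR (- 2^-1) = 1 :> R by exact: expRxMexpNx_1.
have h1 := expR_ge1Dx (- 2^-1 : R).
have h0 := expR_gt0 (2^-1 : R).
have h2 : expR 2^-1 <= 2 :> R by nra.
have -> : (1 : R) = 2^-1 + 2^-1 by field.
rewrite expRD; nra.
Qed.

(* For u = (f - E f) / L, property (tau) applied to u and - u - 1 bounds E exp(u) E exp(-u) by e,
   and both factors are at least 1 by Jensen. *)
Lemma gE_variance n f (L : R) : 0 < L -> lip2 n L f ->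
  gE n (fun x => (f x - gE n f) ^+ 2) <= 12 * L ^+ 2.
Proof.
move=> L0 fL; set m := gE n f.
have fL1 := lip2_lip1 n L f (ltW L0) fL.
have tf : tame n f := tame_lip1 n L f (ltW L0) fL1.
pose u x := L^-1 * (f x - m).
have Ln0 : L != 0 by rewrite gt_eqF.
have u2 : lip2 n 1 u.
  move=> x y; rewrite -mulrBr opprB addrA subrK normrM gtr0_norm ?invr_gt0 // mul1r.
  by rewrite mulrC ler_pdivrMr // mulrC.
have u1 := lip2_lip1 n 1 u ler01 u2.
have nu1 : lip1 n 1 (fun x => - u x) by move=> x y; rewrite -opprD normrN; exact: u1.
have tu := tame_lip1 n 1 u ler01 u1.
have teu := tame_expR n 1 u ler01 u1.
have tenu := tame_expR n 1 _ ler01 nu1.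
have Eu : gE n u = 0.
  rewrite /u gEZ; last by apply: tameB => //; exact: tame_cst.
  by rewrite gEB //; [rewrite gE_cst subrr mulr0|exact: tame_cst].
have Enu : gE n (fun x => - u x) = 0.
  rewrite (_ : (fun _ => _) = (fun x => (-1) * u x)); last by apply/funext => x; rewrite mulN1r.
  by rewrite gEZ // Eu mulr0.
have p1 : 1 <= gE n (fun x => expR (u x)).
  by have := jensen_expR n u 1 ler01 u1; rewrite Eu expR0.
have p2 : 1 <= gE n (fun x => expR (- u x)).
  by have := jensen_expR n _ 1 ler01 nu1; rewrite Enu expR0.
have h : gE n (fun x => expR (u x)) * gE n (fun x => expR (- u x - 1)) <= 1.
  apply: (@property_tau n u _ 1) => //; first exact: lip1_subC.
  (* With D the distance from [x] to [y], [D - 1 <= D^2 / 4]; this is why [- u] is lowered by 1. *)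
  move=> x y; have := u2 x y; rewrite mul1r -enorm_sqr => h.
  have := sqr_ge0 (enorm (x - y) / 2 - 1); have := ler_norm (u x - u y); nra.
rewrite (gE_expR_subC _ _ 1) // in h.
have {}h : gE n (fun x => expR (u x)) * gE n (fun x => expR (- u x)) <= expR 1.
  by rewrite mulrCA expRN mulrC ler_pdivrMr ?expR_gt0 // mul1r in h.
have e3 := expR1_le4.
have su : gE n (fun x => u x ^+ 2) <= 12.
  apply: (@le_trans _ _ (gE n (fun x => 4 * (expR (u x) + expR (- u x) - 2)))).
    apply: le_gE => // [||x].
    - exact: (tameM _ _ _ tu tu).
    - by apply: tameZ; apply: tameB; [exact: tameD|exact: tame_cst].
    - exact: sqr_le_expRD.
  rewrite gEZ; last by apply: tameB; [exact: tameD|exact: tame_cst].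
  rewrite gEB; [|exact: tameD|exact: tame_cst].
  rewrite gED // gE_cst.
  (* From [(P - 1) * (Q - 1) >= 0] and [P * Q <= 4] follows [P + Q <= 5], whence the constant
     [4 * (5 - 2) = 12]. *)
  move: p1 p2 h; set P := gE _ _; set Q := gE _ _ => p1 p2 h; nra.
have -> : (fun x => (f x - m) ^+ 2) = (fun x => L ^+ 2 * u x ^+ 2).
  by apply/funext => x; rewrite /u -exprMn mulrA divff // mul1r.
rewrite gEZ; last exact: (tameM _ _ _ tu tu).
by rewrite mulrC ler_wpM2r // sqr_ge0.
Qed.

(** Tensorizes [Rintegral_gauss_shift_sqr]; the factors [expR] of the squared coordinates of [k]
    multiply. It compares the law of the data under two means. *)
Lemma gE_shift_sqr n f (k : 'rV[R]_n) : tame n f -> (forall x, 0 <= f x) ->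
  gE n f ^+ 2 <= expR (dotv k k) * gE n (fun x => f (x + k) ^+ 2).
Proof.
elim: n f k => [|n IH] f k tf f0.
  by rewrite /gE /= [k]thinmx0 addr0 /dotv big_ord0 expR0 mul1r.
have [s [w kE]] := cons_ex n k; rewrite {}kE {k} dotv_cons.
have sl a := tame_slice n f a tf.
have tk := tame_shift n.+1 f (cons n s w) tf; have tk2 := tameM _ _ _ tk tk.
rewrite !gES //.
have gf := expgrowth_slice _ _ (gE_specP n) tf.
have g0 a : 0 <= gE n (fun v => f (cons n a v)) by apply: gE_ge0.
apply: (le_trans (Rintegral_gauss_shift_sqr _ s gf g0)).
rewrite -expr2 expRD -mulrA ler_wpM2l ?expR_ge0 //.
have gk2 := expgrowth_slice _ _ (gE_specP n) tk2.
rewrite -RintegralZl //; last exact: integrable_expgrowth.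
have pw a : gE n (fun v => f (cons n (a + s) v)) ^+ 2 <=
    expR (dotv w w) * gE n (fun v => f (cons n a v + cons n s w) ^+ 2).
  apply: (le_trans (IH _ w (sl (a + s)) _)) => //.
  rewrite ler_wpM2l ?expR_ge0 // le_eqVlt; apply/orP; left; apply/eqP.
  by congr gE; apply/funext => v; rewrite consD.
have iR := integrableZl measurableT (expR (dotv w w)) (integrable_expgrowth _ gk2).
have iR' : gam.-integrable setT (EFin \o (fun a => expR (dotv w w) * gE n (fun v => f (cons n a v + cons n s w) ^+ 2))).
  by move: iR; apply: eq_integrable.
have iL : gam.-integrable setT (EFin \o (fun a => gE n (fun v => f (cons n (a + s) v)) ^+ 2)).
  apply: (le_integrable _ _ _ iR') => //=.
    apply/measurable_EFinP; apply: continuous_measurable_fun => a.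
    have cg : continuous (fun a => gE n (fun v => f (cons n (a + s) v))).
      move=> b; apply: (@continuous_comp _ _ _ (fun a : R => a + s) (fun a => gE n (fun v => f (cons n a v)))); last exact: (expgrowth_continuous _ gf).
      by apply: (@continuousD R R^o R) => //; exact: cst_continuous.
    exact: (cvgM (cg a) (cg a)).
  move=> a _; rewrite lee_fin ger0_norm ?sqr_ge0 //.
  by apply: (le_trans (pw a)); exact: ler_norm.
by apply: le_Rintegral => // a _; exact: pw.
Qed.

End Concentration.

(** * Projections and local suprema *)

Section Euclid.
Context {R : realType}.
Variable n : nat.
Implicit Types (x y z : 'rV[R]_n) (k : R).

Lemma dotvC x y : dotv x y = dotv y x.
Proof. by apply: eq_bigr => i _; rewrite mulrC. Qed.

Lemma dotvDl x y z : dotv (x + y) z = dotv x z + dotv y z.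
Proof. by rewrite /dotv -big_split; apply: eq_bigr => i _; rewrite mxE mulrDl. Qed.

Lemma dotvNl x z : dotv (- x) z = - dotv x z.
Proof. by rewrite /dotv -sumrN; apply: eq_bigr => i _; rewrite mxE mulNr. Qed.

Lemma dotvZl k x z : dotv (k *: x) z = k * dotv x z.
Proof. by rewrite /dotv mulr_sumr; apply: eq_bigr => i _; rewrite mxE mulrA. Qed.

Lemma dotvDr x y z : dotv z (x + y) = dotv z x + dotv z y.
Proof. by rewrite dotvC dotvDl !(dotvC z). Qed.

Lemma dotvNr x z : dotv z (- x) = - dotv z x.
Proof. by rewrite dotvC dotvNl (dotvC z). Qed.

Lemma dotvZr k x z : dotv z (k *: x) = k * dotv z x.
Proof. by rewrite dotvC dotvZl (dotvC z). Qed.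

Definition dotvE := (dotvDl, dotvDr, dotvNl, dotvNr, dotvZl, dotvZr).

Lemma dotv_eq0 x : dotv x x = 0 -> x = 0.
Proof.
move=> /eqP; rewrite /dotv psumr_eq0 => [/allP h|i _]; last by rewrite -expr2 sqr_ge0.
apply/rowP => i; rewrite mxE; have := h i (mem_index_enum i).
by rewrite /= mulf_eq0 orbb => /eqP.
Qed.

Lemma cauchy_schwarz x y : dotv x y <= enorm x * enorm y.
Proof.
have h : dotv x y ^+ 2 <= (enorm x * enorm y) ^+ 2.
  rewrite exprMn !enorm_sqr.
  have [y0|yn0] := eqVneq (dotv y y) 0.
    have -> : dotv x y = 0 by rewrite (dotv_eq0 _ y0) -(scale0r (0 : 'rV[R]_n)) dotvZr mul0r.
    by rewrite y0 mulr0 expr0n.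
  have yp : 0 < dotv y y by rewrite lt_def yn0 dotv_ge0.
  (* This vector is [dotv y y] times the component of [x] orthogonal to [y]. *)
  have := dotv_ge0 _ (dotv y y *: x - dotv x y *: y); rewrite !dotvE (dotvC y x).
  move=> h; rewrite -(ler_pM2l yp); lra.
apply: (le_trans (ler_norm _)).
rewrite -[leRHS]ger0_norm ?mulr_ge0 ?enorm_ge0 //.
by rewrite -ler_sqr ?nnegrE ?normr_ge0 // !real_normK ?num_real.
Qed.

Lemma enormN x : enorm (- x) = enorm x.
Proof. by rewrite /enorm dotvNl dotvNr opprK. Qed.

Lemma enormB x y : enorm (x - y) = enorm (y - x).
Proof. by rewrite -enormN opprB. Qed.

Lemma enorm_le k x : 0 <= k -> dotv x x <= k ^+ 2 -> enorm x <= k.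
Proof. by move=> k0; rewrite -enorm_sqr ler_sqr // nnegrE enorm_ge0. Qed.

Lemma enormD x y : enorm (x + y) <= enorm x + enorm y.
Proof.
apply: enorm_le; first by rewrite addr_ge0 ?enorm_ge0.
rewrite !dotvE (dotvC y x) sqrrD !enorm_sqr.
have := cauchy_schwarz x y; lra.
Qed.

Lemma enorm_triangle z x y : enorm (x - y) <= enorm (x - z) + enorm (z - y).
Proof.
by have -> : x - y = (x - z) + (z - y); [rewrite addrA subrK|exact: enormD].
Qed.

Lemma enormZ k x : enorm (k *: x) = `|k| * enorm x.
Proof. by rewrite /enorm dotvZl dotvZr mulrA -expr2 sqrtrM ?sqr_ge0 // sqrtr_sqr. Qed.

Lemma enorm0 : enorm (0 : 'rV[R]_n) = 0.
Proof. by rewrite -(scale0r 0) enormZ normr0 mul0r. Qed.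

Lemma enorm_dist x y : `|enorm x - enorm y| <= enorm (x - y).
Proof.
have h (a b : 'rV[R]_n) : enorm a <= enorm b + enorm (a - b).
  by have := enormD b (a - b); rewrite subrKC.
rewrite ler_norml; apply/andP; split.
  by have := h y x; rewrite enormB; lra.
by have := h x y; lra.
Qed.

Lemma coord_le_enorm x i : `|x ord0 i| <= enorm x.
Proof.
rewrite -ler_sqr ?nnegrE ?enorm_ge0 // real_normK ?num_real // enorm_sqr.
by rewrite /dotv (bigD1 i) //= -expr2 lerDl; apply: sumr_ge0 => j _; rewrite -expr2 sqr_ge0.
Qed.

(** The norm carrying the topology of row vectors is the maximum norm, which the Euclidean norm
    dominates. *)
Lemma ebounded_bounded (K : set 'rV[R]_n) : ebounded K -> bounded_set K.
Proof.
move=> [M KM]; exists `|M|; split; first exact: num_real.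
move=> M' MM x Kx; apply: (@le_trans _ _ `|M|); last exact: ltW.
rewrite [leLHS]/Num.norm /= mx_normrE; apply: bigmax_le => // -[i j] _ /=.
by rewrite (ord1 i); apply: (le_trans (coord_le_enorm _ _)); apply: (le_trans (KM x Kx)); exact: ler_norm.
Qed.

Lemma continuous_dist2 x : continuous (fun t : 'rV[R]_n => dotv (x - t) (x - t)).
Proof.
rewrite /dotv; elim: (index_enum _) => [|i r IH].
  by rewrite (_ : (fun _ => _) = cst 0); [exact: cst_continuous|apply/funext => t; rewrite big_nil].
have h : continuous (fun t : 'rV[R]_n => (x - t) ord0 i).
  rewrite (_ : (fun _ => _) = (fun t : 'rV[R]_n => x ord0 i - t ord0 i)); last by apply/funext => u; rewrite !mxE.
  move=> t; exact: (@cvgB _ R^o _ _ _ _ _ _ _ (cvg_cst _) (@coord_continuous R 1 n ord0 i t)).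
rewrite (_ : (fun _ => _) = (fun t => (x - t) ord0 i * (x - t) ord0 i +
  \sum_(j <- r) (x - t) ord0 j * (x - t) ord0 j)); last by apply/funext => t; rewrite big_cons.
by move=> t; exact: (@cvgD _ R^o _ _ _ _ _ _ _ (cvgM (h t) (h t)) (IH t)).
Qed.

End Euclid.

(** * Projection onto a closed bounded convex set *)

Section Projection.
Context {R : realType}.
Variables (n : nat) (K : set 'rV[R]_n).
Hypotheses (K0 : K !=set0) (Kcl : closed K) (Kcv : convex_setE K) (Kb : ebounded K).
Implicit Types (x y t : 'rV[R]_n).

(** [K] is compact, so a minimizer exists and [lse] does not fall back on its default [0]. *)
Lemma lseP y : K (lse K y) /\ forall t, K t -> enorm (y - lse K y) <= enorm (y - t).
Proof.
pose P : set 'rV[R]_n := [set nu | K nu /\ forall t, K t -> enorm (y - nu) <= enorm (y - t)].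
apply: (@xgetPex _ (0 : 'rV[R]_n) P).
have cK : compact K by apply: bounded_closed_compact => //; exact: ebounded_bounded.
have [|m] := @EVT_min_rV R n (fun t => dotv (y - t) (y - t)) K K0 cK.
  by apply: continuous_subspaceT; exact: continuous_dist2.
rewrite inE => Km hm; exists m; split => // t Kt.
by rewrite ler_sqrt ?dotv_ge0 //; apply: hm; rewrite inE.
Qed.

Lemma lse_in y : K (lse K y). Proof. by have [] := lseP y. Qed.

Lemma lse_variational y t : K t -> dotv (y - lse K y) (t - lse K y) <= 0.
Proof.
move=> Kt; set m := lse K y; have [Km hm] := lseP y; rewrite -/m in Km hm.
rewrite leNgt; apply/negP => a0.
set a := dotv (y - m) (t - m) in a0.
pose b := dotv (t - m) (t - m); have b0 : 0 <= b by exact: dotv_ge0.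
(* A step [l] towards [t] changes the squared distance by [l * (l * b - 2 * a)]; this [l] lies in
   (0, 1] and makes the change negative. *)
pose l := a / (a + b); have ab : 0 < a + b by rewrite ltr_pwDl.
have l0 : 0 < l by rewrite divr_gt0.
have l1 : l <= 1 by rewrite ler_pdivrMr // mul1r lerDl.
have Kl : K (l *: t + (1 - l) *: m) by apply: Kcv => //; rewrite ltW.
have e : y - (l *: t + (1 - l) *: m) = (y - m) - l *: (t - m).
  by apply/rowP => i; rewrite !mxE; ring.
have := hm _ Kl; rewrite e -ler_sqr ?nnegrE ?enorm_ge0 // !enorm_sqr.
have -> : dotv (y - m - l *: (t - m)) (y - m - l *: (t - m)) = dotv (y - m) (y - m) - 2 * l * a + l ^+ 2 * b.
  by rewrite (dotvDl _ (y - m)) !(dotvDr _ (y - m)) !dotvNl !dotvNr !dotvZl !dotvZr (dotvC _ (t - m) (y - m)) -/a -/b; ring.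
have : l * b < 2 * a.
  rewrite /l mulrAC ltr_pdivrMr //; nra.
move=> h1 h2; have : l * (l * b) < l * (2 * a) by rewrite ltr_pM2l.
lra.
Qed.

(** Add the variational inequalities at the two projections, each tested against the other. *)
Lemma lse_nonexpansive x y : enorm (lse K x - lse K y) <= enorm (x - y).
Proof.
have h1 := lse_variational x _ (lse_in y); have h2 := lse_variational y _ (lse_in x).
set a := lse K x in h1 h2 *; set b := lse K y in h1 h2 *.
have : dotv (a - b) (a - b) <= dotv (x - y) (a - b).
  by move: h1 h2; rewrite !dotvE (dotvC _ b a); lra.
have := cauchy_schwarz n (x - y) (a - b); rewrite -enorm_sqr => h3 h4.
have [e0|en0] := eqVneq (enorm (a - b)) 0; first by rewrite e0 enorm_ge0.
have ep : 0 < enorm (a - b) by rewrite lt_def en0 enorm_ge0.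
rewrite -(ler_pM2r ep); apply: le_trans h3; by rewrite -expr2.
Qed.

End Projection.

(* [lra], [nra] and [field] compare atoms up to conversion, so local definitions must be
   made opaque first. *)
Ltac opaque := repeat match goal with x := _ |- _ => clearbody x end.
Ltac opaque_lra := opaque; lra.
Ltac opaque_nra := opaque; nra.
Ltac opaque_field := opaque; field.

(** * Dyadic sums *)

Section Dyadic.
Context {R : realType}.

Lemma sum_pow2 (t : R) N : \sum_(j < N) 2 ^+ j * t = (2 ^+ N - 1) * t.
Proof.
elim: N => [|N IH]; first by rewrite big_ord0 expr0 subrr mul0r.
by rewrite big_ord_recr /= IH exprS; ring.
Qed.

Lemma sum_half_le2 N : \sum_(j < N) 2^-1 ^+ j <= 2 :> R.
Proof.
suff -> : \sum_(j < N) 2^-1 ^+ j = 2 - 2 * 2^-1 ^+ N :> R.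
  by rewrite lerBlDr lerDl mulr_ge0 // exprn_ge0.
elim: N => [|N IH]; first by rewrite big_ord0 expr0 mulr1 subrr.
by rewrite big_ord_recr /= IH exprS; field.
Qed.

(** A layer-cake bound: the levels [2 ^+ j * t] not exceeding [h] add up to at least [h - t], and
    each is paid for by [Q j >= 1]. *)
Lemma dyadic_cover (h t : R) (Q : nat -> R) J : 0 < t -> (forall j, 0 <= Q j) ->
  (forall j, (j < J)%N -> 2 ^+ j * t <= h -> 1 <= Q j) -> h <= 2 ^+ J * t ->
  h <= t + \sum_(j < J) 2 ^+ j * t * Q j.
Proof.
move=> t0 Q0; elim: J => [|J IH] Q1 hJ; first by rewrite big_ord0 addr0 -[t]mul1r -(expr0 2).
have [Jh|Jh] := leP (2 ^+ J * t) h; last first.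
  rewrite big_ord_recr /= addrA; apply: (@le_trans _ _ (t + \sum_(j < J) 2 ^+ j * t * Q j)).
    by apply: IH => [j jJ|]; [apply: Q1; rewrite ltnS ltnW|exact: ltW].
  by rewrite lerDl mulr_ge0 // mulr_ge0 ?exprn_ge0 // ltW.
apply: (@le_trans _ _ (t + \sum_(j < J.+1) 2 ^+ j * t)).
  by rewrite sum_pow2; move: hJ; lra.
rewrite lerD2l; apply: ler_sum => j _.
have jt : 0 < 2 ^+ j * t by rewrite mulr_gt0 // exprn_gt0.
rewrite ler_peMr ?(ltW jt) //; apply: Q1 => //; apply: le_trans Jh.
by rewrite ler_pM2r // ler_weXn2l ?ler1n // -ltnS.
Qed.

Lemma tame_sum n J (f : 'I_J -> 'rV[R]_n -> R) : (forall j, tame n (f j)) ->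
  tame n (fun x => \sum_(j < J) f j x).
Proof.
elim: J f => [|J IH] f tf.
  by rewrite (_ : (fun _ => _) = fun=> 0); [exact: tame_cst|apply/funext => x; rewrite big_ord0].
rewrite (_ : (fun _ => _) = (fun x => f ord0 x + \sum_(j < J) f (lift ord0 j) x)).
  by apply: tameD => //; apply: IH.
by apply/funext => x; rewrite big_ord_recl.
Qed.

Lemma gE_sum n J (f : 'I_J -> 'rV[R]_n -> R) : (forall j, tame n (f j)) ->
  gE n (fun x => \sum_(j < J) f j x) = \sum_(j < J) gE n (f j).
Proof.
elim: J f => [|J IH] f tf.
  by rewrite big_ord0 (_ : (fun _ => _) = fun=> 0) ?gE_cst //; apply/funext => x; rewrite big_ord0.
rewrite big_ord_recl -IH // -gED //; last by apply: tame_sum.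
by congr gE; apply/funext => x; rewrite big_ord_recl.
Qed.

End Dyadic.

(** * Local suprema and the least squares error *)

Section LocalSup.
Context {R : realType}.
Variables (n : nat) (K : set 'rV[R]_n).
Hypotheses (K0 : K !=set0) (Kcl : closed K) (Kcv : convex_setE K) (Kb : ebounded K).
Implicit Types (x y t mu nu : 'rV[R]_n) (r s : R).

Lemma frac_itv (a b : R) : 0 <= a -> a <= b -> 0 < b -> 0 <= a / b <= 1.
Proof. by move=> a0 ab b0; rewrite divr_ge0 ?(ltW b0) //= ler_pdivrMr // mul1r. Qed.

Definition lsup mu r x : R := sup [set dotv x t | t in eball mu r `&` K].

Lemma lsup_ub mu r x t : K t -> enorm (t - mu) <= r -> dotv x t <= lsup mu r x.
Proof.
move=> Kt tr; apply: ub_le_sup; last by exists t.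
have [M KM] := Kb; exists (enorm x * M) => _ [u [_ Ku] <-].
by apply: (le_trans (cauchy_schwarz _ _ _)); rewrite ler_wpM2l ?enorm_ge0 // KM.
Qed.

Lemma lsup_le mu r x B : K mu -> 0 <= r ->
  (forall t, K t -> enorm (t - mu) <= r -> dotv x t <= B) -> lsup mu r x <= B.
Proof.
move=> Kmu r0 h; apply: ge_sup; last by move=> _ [u [ur Ku] <-]; exact: h.
by exists (dotv x mu), mu => //; split => //; rewrite /eball /= subrr enorm0.
Qed.

Lemma lsup_subball mu r nu s x : K mu -> 0 <= r -> enorm (mu - nu) + r <= s ->
  lsup mu r x <= lsup nu s x.
Proof.
move=> Kmu r0 rs; apply: lsup_le => // t Kt tr; apply: lsup_ub => //.
by apply: (le_trans (enorm_triangle _ mu _ _)); lra.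
Qed.

Lemma lsup_mono mu r s x : K mu -> 0 <= r -> r <= s -> lsup mu r x <= lsup mu s x.
Proof. by move=> Kmu r0 rs; apply: lsup_subball => //; rewrite subrr enorm0 add0r. Qed.

(** Without the term [dotv x mu] only vectors [t - mu] of length at most [r] are tested, so the
    Lipschitz constant ignores the position of [K]. The term cancels in the differences of
    [lip2_lsupB]. *)
Lemma lsup_centered_le mu r x y : K mu -> 0 <= r ->
  lsup mu r x - dotv x mu <= lsup mu r y - dotv y mu + r * enorm (x - y).
Proof.
move=> Kmu r0; rewrite lerBlDr; apply: lsup_le => // t Kt tr.
have h1 := lsup_ub mu r y t Kt tr.
have h2 := cauchy_schwarz _ (x - y) (t - mu).
have h3 : enorm (x - y) * enorm (t - mu) <= r * enorm (x - y).
  by rewrite mulrC ler_wpM2r ?enorm_ge0.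
move: h2; rewrite !dotvE; lra.
Qed.

Lemma lip2_lsupB mu r s : K mu -> 0 <= r -> 0 <= s ->
  lip2 n (s + r) (fun x => lsup mu s x - lsup mu r x).
Proof.
move=> Kmu r0 s0 x y.
have h1 := lsup_centered_le mu r x y Kmu r0; have h2 := lsup_centered_le mu r y x Kmu r0.
have h3 := lsup_centered_le mu s x y Kmu s0; have h4 := lsup_centered_le mu s y x Kmu s0.
rewrite (enormB _ y x) in h2 h4; rewrite ler_norml; apply/andP; split; lra.
Qed.

Lemma lip2_lsup mu r : K mu -> 0 <= r -> lip2 n (r + enorm mu) (lsup mu r).
Proof.
move=> Kmu r0 x y.
have h1 := lsup_centered_le mu r x y Kmu r0; have h2 := lsup_centered_le mu r y x Kmu r0.
have c1 := cauchy_schwarz _ (x - y) mu; have c2 := cauchy_schwarz _ (y - x) mu.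
move: h2 c1 c2; rewrite !(enormB _ y x) !dotvE => h2 c1 c2.
rewrite ler_norml; apply/andP; split; lra.
Qed.

Lemma tame_lsup mu r : K mu -> 0 <= r -> tame n (lsup mu r).
Proof.
move=> Kmu r0; have h : 0 <= r + enorm mu by rewrite addr_ge0 ?enorm_ge0.
exact: (tame_lip1 _ _ _ h (lip2_lip1 _ _ _ h (lip2_lsup mu r Kmu r0))).
Qed.

Lemma segment_ball mu (a b : 'rV[R]_n) (l r s q : R) : 0 <= l <= 1 ->
  enorm (a - mu) <= r -> enorm (b - mu) <= s -> l * (r - s) + s <= q ->
  enorm (l *: a + (1 - l) *: b - mu) <= q.
Proof.
move=> /andP[l0 l1] ar bs; apply: le_trans.
have -> : l *: a + (1 - l) *: b - mu = l *: (a - mu) + (1 - l) *: (b - mu).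
  by apply/rowP => i; rewrite !mxE; ring.
apply: (le_trans (enormD _ _ _)); rewrite !enormZ !ger0_norm ?subr_ge0 //.
have -> : l * (r - s) + s = l * r + (1 - l) * s by ring.
by apply: lerD; apply: ler_wpM2l => //; rewrite subr_ge0.
Qed.

(** A convex combination of points within [q] and within [r] of [mu] stays in [K] and within the
    interpolated radius [s]. *)
Lemma lsup_concave mu r s (q : R) x : K mu -> 0 <= r -> r < s -> s < q ->
  (s - r) * lsup mu q x + (q - s) * lsup mu r x <= (q - r) * lsup mu s x.
Proof.
move=> Kmu r0 rs sq.
have sr : 0 < s - r by rewrite subr_gt0.
have qs : 0 < q - s by rewrite subr_gt0.
have qr : 0 < q - r by lra.
rewrite -lerBrDr.
rewrite mulrC -ler_pdivlMr //; apply: lsup_le => //; first by lra.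
move=> t Kt tq; rewrite ler_pdivlMr // lerBrDr -lerBrDl.
rewrite [_ * lsup mu r x]mulrC -ler_pdivlMr //; apply: lsup_le => // u Ku ur.
rewrite ler_pdivlMr // lerBrDl.
pose l := (s - r) / (q - r).
have l01 : 0 <= l <= 1.
  by apply: frac_itv => //; lra.
have lE : l * (q - r) = s - r by rewrite /l divfK // gt_eqF.
have h := lsup_ub mu s x (l *: t + (1 - l) *: u) (Kcv _ _ Kt Ku _ l01).
have {}h : dotv x (l *: t + (1 - l) *: u) <= lsup mu s x.
  by apply: h; apply: (segment_ball _ _ _ _ q r) => //; rewrite lE; lra.
rewrite dotvDr !dotvZr in h.
have : (q - r) * (l * dotv x t + (1 - l) * dotv x u) <= (q - r) * lsup mu s x by rewrite ler_pM2l.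
have -> : (q - r) * (l * dotv x t + (1 - l) * dotv x u) = (l * (q - r)) * dotv x t + ((q - r) - l * (q - r)) * dotv x u by ring.
rewrite lE; lra.
Qed.

Variables (sigma : R).
Hypothesis sigma0 : 0 < sigma.

Definition lserr mu x : R := enorm (lse K (mu + sigma *: x) - mu).

Lemma lserr_ge0 mu x : 0 <= lserr mu x.
Proof. exact: enorm_ge0. Qed.

(** The variational inequality at [mu + sigma *: x], where the part not involving [x] is bounded by
    Cauchy-Schwarz after recentring at [mu]. *)
Lemma lserr_variational mu x t : K t ->
  sigma * dotv x (t - lse K (mu + sigma *: x)) <= lserr mu x * (enorm (t - mu) - lserr mu x).
Proof.
move=> Kt; have := lse_variational _ _ K0 Kcl Kcv Kb (mu + sigma *: x) t Kt.
rewrite /lserr; set m := lse K _ => h.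
have := cauchy_schwarz _ (m - mu) (t - mu).
have := enorm_sqr _ (m - mu); move: h; rewrite !dotvE (dotvC _ m mu); lra.
Qed.

(* The least squares error is [sigma] times a supergradient of the concave function
   [lsup mu ^~ x] at the error itself; the next two lemmas are the two sides of this. *)
Lemma lsup_increment_le mu x r (q : R) : K mu -> lserr mu x <= r -> r < q ->
  sigma * (lsup mu q x - lsup mu r x) <= lserr mu x * (q - r).
Proof.
move=> Kmu er rq; have e0 := lserr_ge0 mu x.
set e := lserr mu x in er e0 *; have qe : 0 < q - e by lra.
suff h : lsup mu q x <= lsup mu r x + e * (q - r) / sigma.
  by rewrite -ler_pdivlMl // lerBlDl [_^-1 * _]mulrC.
apply: lsup_le => //; first by lra.
move=> t Kt tq; set m := lse K (mu + sigma *: x).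
pose l := (r - e) / (q - e).
have l01 : 0 <= l <= 1.
  by apply: frac_itv => //; lra.
have lE : l * (q - e) = r - e by rewrite /l divfK // gt_eqF.
have Km : K m by exact: lse_in.
have h := lsup_ub mu r x _ (Kcv _ _ Kt Km _ l01).
have {}h : dotv x (l *: t + (1 - l) *: m) <= lsup mu r x.
  by apply: h; apply: (segment_ball _ _ _ _ q e) => //; rewrite -/e lE; lra.
have v := lserr_variational mu x t Kt; rewrite -/m -/e in v.
rewrite addrC -lerBlDr ler_pdivlMr //.
have v2 : sigma * dotv x (t - m) <= e * (q - e).
  by apply: (le_trans v); apply: ler_wpM2l => //; rewrite lerD2r.
have {}v2 : (1 - l) * (sigma * dotv x (t - m)) <= (1 - l) * (e * (q - e)).
  by apply: ler_wpM2l => //; rewrite subr_ge0; case/andP: l01.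
have {}v2 : (1 - l) * (sigma * dotv x (t - m)) <= e * (q - r).
  apply: (le_trans v2); have -> : (1 - l) * (e * (q - e)) = e * ((q - e) - l * (q - e)) by ring.
  by rewrite lE; lra.
have h2 : sigma * (dotv x t - lsup mu r x) <= sigma * (dotv x t - dotv x (l *: t + (1 - l) *: m)).
  by rewrite ler_pM2l // lerD2l lerN2.
rewrite mulrC; apply: (le_trans h2); apply: le_trans v2.
by rewrite !dotvE le_eqVlt; apply/orP; left; apply/eqP; ring.
Qed.

Lemma lsup_increment_ge mu x r (q : R) : K mu -> 0 <= r -> r < lserr mu x -> r <= q -> q <= lserr mu x ->
  lserr mu x * (q - r) <= sigma * (lsup mu q x - lsup mu r x).
Proof.
move=> Kmu r0 re rq qe; have e0 := lserr_ge0 mu x.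
set e := lserr mu x in re qe e0 *; have er : 0 < e - r by lra.
suff h : lsup mu r x <= lsup mu q x - e * (q - r) / sigma.
  by rewrite -ler_pdivrMl // lerBrDl -lerBrDr [_^-1 * _]mulrC.
apply: lsup_le => // t Kt tr; set m := lse K (mu + sigma *: x).
pose l := (e - q) / (e - r).
have l01 : 0 <= l <= 1.
  by apply: frac_itv => //; lra.
have lE : l * (e - r) = e - q by rewrite /l divfK // gt_eqF.
have Km : K m by exact: lse_in.
have h := lsup_ub mu q x _ (Kcv _ _ Kt Km _ l01).
have {}h : dotv x (l *: t + (1 - l) *: m) <= lsup mu q x.
  by apply: h; apply: (segment_ball _ _ _ _ r e) => //; rewrite -/e -[r - e]opprB mulrN lE; lra.
have v := lserr_variational mu x t Kt; rewrite -/m -/e in v.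
have v2 : sigma * dotv x (t - m) <= e * (r - e).
  by apply: (le_trans v); apply: ler_wpM2l => //; rewrite lerD2r.
have {}v2 : (1 - l) * (sigma * dotv x (t - m)) <= (1 - l) * (e * (r - e)).
  by apply: ler_wpM2l => //; rewrite subr_ge0; case/andP: l01.
have {}v2 : (1 - l) * (sigma * dotv x (t - m)) <= - (e * (q - r)).
  apply: (le_trans v2); have -> : (1 - l) * (e * (r - e)) = e * (l * (e - r) - (e - r)) by ring.
  by rewrite lE; lra.
rewrite lerBrDr -lerBrDl ler_pdivrMr //.
have h2 : sigma * (dotv x (l *: t + (1 - l) *: m) - dotv x t) <= sigma * (lsup mu q x - dotv x t).
  by rewrite ler_pM2l // lerD2r.
rewrite [leRHS]mulrC; apply: le_trans h2.
have -> : dotv x (l *: t + (1 - l) *: m) - dotv x t = - ((1 - l) * dotv x (t - m)).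
  by rewrite !dotvE; ring.
by rewrite mulrN lerNr; apply: le_trans v2; rewrite mulrCA.
Qed.

Lemma lip2_lserr mu : lip2 n sigma (lserr mu).
Proof.
move=> x y; apply: (le_trans (enorm_dist _ _ _)).
have -> : lse K (mu + sigma *: x) - mu - (lse K (mu + sigma *: y) - mu) =
  lse K (mu + sigma *: x) - lse K (mu + sigma *: y) by rewrite opprB addrA subrK.
apply: (le_trans (lse_nonexpansive _ _ K0 Kcl Kcv Kb _ _)).
by rewrite opprD addrACA subrr add0r -scalerBr enormZ gtr0_norm.
Qed.

Lemma tame_lserr mu : tame n (lserr mu).
Proof.
have s0 := ltW sigma0.
exact: (tame_lip1 _ _ _ s0 (lip2_lip1 _ _ _ s0 (lip2_lserr mu))).
Qed.

Lemma tame_lserr2 mu : tame n (fun x => lserr mu x ^+ 2).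
Proof. exact: (tameM _ _ _ (tame_lserr mu) (tame_lserr mu)). Qed.

Definition risk mu : R := gE n (fun x => lserr mu x ^+ 2).
Definition width mu r : R := gE n (lsup mu r).

Lemma risk_ge0 mu : 0 <= risk mu.
Proof. by apply: gE_ge0; [exact: tame_lserr2|move=> x; exact: sqr_ge0]. Qed.

Lemma gE_lsupB mu r s : K mu -> 0 <= r -> 0 <= s ->
  gE n (fun x => lsup mu s x - lsup mu r x) = width mu s - width mu r.
Proof. by move=> Kmu r0 s0; rewrite gEB //; exact: tame_lsup. Qed.

Lemma lsupB_variance mu r s : K mu -> 0 <= r -> 0 < s ->
  tame n (fun x => (lsup mu s x - lsup mu r x - (width mu s - width mu r)) ^+ 2) /\
  gE n (fun x => (lsup mu s x - lsup mu r x - (width mu s - width mu r)) ^+ 2) <= 12 * (s + r) ^+ 2.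
Proof.
move=> Kmu r0 s0; split.
  have t : tame n (fun x => lsup mu s x - lsup mu r x - (width mu s - width mu r)).
    by apply: tameB; [apply: tameB; apply: tame_lsup => //; exact: ltW|exact: tame_cst].
  exact: (tameM _ _ _ t t).
rewrite -gE_lsupB //; last exact: ltW.
apply: gE_variance; first by rewrite ltr_pwDl.
by apply: lip2_lsupB => //; exact: ltW.
Qed.

Lemma risk_sqr mu : gE n (lserr mu) ^+ 2 <= risk mu.
Proof.
set m := gE n _; have tm := tame_lserr mu.
have t2 : tame n (fun x => lserr mu x - m) by apply: tameB => //; exact: tame_cst.
have h : 0 <= gE n (fun x => (lserr mu x - m) * (lserr mu x - m)).
  by apply: gE_ge0 => [|x]; [exact: (tameM _ _ _ t2 t2)|rewrite -expr2 sqr_ge0].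
have e : (fun x => (lserr mu x - m) * (lserr mu x - m)) = (fun x => (- (2 * m)) * lserr mu x + (lserr mu x ^+ 2 + m ^+ 2)).
  by apply/funext => x; ring.
have tr := tame_lserr2 mu.
rewrite e gE_linear // in h; last by apply: tameD => //; exact: tame_cst.
rewrite gED // in h; last exact: tame_cst.
by rewrite gE_cst -/(risk mu) -/m in h; lra.
Qed.

Lemma width_concave mu r s (q : R) : K mu -> 0 <= r -> r < s -> s < q ->
  (s - r) * width mu q + (q - s) * width mu r <= (q - r) * width mu s.
Proof.
move=> Kmu r0 rs sq.
have tr : tame n (lsup mu r) by apply: tame_lsup.
have ts : tame n (lsup mu s) by apply: tame_lsup => //; lra.
have tq : tame n (lsup mu q) by apply: tame_lsup => //; lra.
rewrite /width -!gEZ // -gED //; try exact: tameZ.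
apply: le_gE; [by apply: tameD; exact: tameZ|exact: tameZ|] => x.
exact: lsup_concave.
Qed.

(* Chebyshev majorant of the indicator of [lserr mu x <= r] (see [tailq_ge1]); unlike the
   indicator it is tame. *)
Definition tailq mu r (q g : R) x : R :=
  (g ^+ 2)^-1 * (lsup mu q x - lsup mu r x - (width mu q - width mu r)) ^+ 2.

Lemma tailq_ge0 mu r (q g : R) x : 0 <= tailq mu r q g x.
Proof. by rewrite mulr_ge0 ?sqr_ge0 // invr_ge0 sqr_ge0. Qed.

Lemma tame_tailq mu r (q g : R) : K mu -> 0 <= r -> 0 < q -> tame n (tailq mu r q g).
Proof. by move=> Kmu r0 q0; apply: tameZ; have [] := lsupB_variance mu r q Kmu r0 q0. Qed.

Lemma gE_tailq mu r (q g : R) : K mu -> 0 <= r -> 0 < q -> 0 < g ->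
  gE n (tailq mu r q g) <= 12 * (q + r) ^+ 2 / g ^+ 2.
Proof.
move=> Kmu r0 q0 g0; have [t v] := lsupB_variance mu r q Kmu r0 q0.
by rewrite gEZ // mulrC ler_pM2r // invr_gt0 exprn_gt0.
Qed.

Lemma tailq_ge1 mu r (q g : R) x : K mu -> 0 <= r -> r < q -> 0 < g ->
  r * (q - r) / sigma + g <= width mu q - width mu r ->
  lserr mu x <= r -> 1 <= tailq mu r q g x.
Proof.
move=> Kmu r0 rq g0 hg mr; have h := lsup_increment_le mu x r q Kmu mr rq.
have {}h : lsup mu q x - lsup mu r x <= r * (q - r) / sigma.
  rewrite ler_pdivlMr // mulrC; apply: (le_trans h); apply: ler_wpM2r => //.
  by rewrite subr_ge0 ltW.
rewrite /tailq ler_pdivlMl ?exprn_gt0 // mulr1 -[leRHS]sqrrN ler_sqr ?nnegrE; lra.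
Qed.

Lemma risk_lower nu (c e : R) : K nu -> 1 < c -> 100 * sigma <= e ->
  (9 / (4 * c) + 3 / 2) * (e ^+ 2 / sigma) <= width nu (2 * e) - width nu (e / c) ->
  (e / c) ^+ 2 <= risk nu.
Proof.
move=> Knu c1 se.
have e0 : 0 < e by apply: lt_le_trans se; rewrite mulr_gt0.
have c0 : 0 < c by opaque_lra.
set d := e / c; set b := e ^+ 2 / sigma => hD.
have d0 : 0 < d by rewrite divr_gt0.
have de : d < e by rewrite /d ltr_pdivrMr // ltr_pMr.
have b0 : 0 < b by rewrite divr_gt0 // exprn_gt0.
have bE : b * sigma = e ^+ 2 by rewrite /b divfK // gt_eqF.
have be : 100 * e <= b.
  by rewrite /b ler_pdivlMr // expr2 mulrAC ler_pM2r.
have be2 : 10000 * e ^+ 2 <= b ^+ 2.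
  have -> : 10000 * e ^+ 2 = (100 * e) ^+ 2 by ring.
  by rewrite ler_sqr ?nnegrE ?(ltW b0) // mulr_ge0 // ltW.
pose W := width nu; rewrite -/(W _) -/(W d) in hD.
pose T := (9 / (4 * c) + 1 / 2) * b.
have DT : b + T <= W (2 * e) - W d.
  by apply: le_trans hD; rewrite /T le_eqVlt; apply/orP; left; apply/eqP; opaque_field; rewrite gt_eqF.
pose tau k := d / 8 / 2 ^+ k.
have tau0 k : 0 < tau k by rewrite !divr_gt0 // exprn_gt0.
have exk : exists k, T <= W (2 * e) - W (d + tau k).
  pose X := `|W d - W 0|; pose k := (Num.truncn (X / b)).+1; exists k.
  have Xk : X <= b * 2 ^+ k.
    have h1 : X / b < k%:R.
      by have /andP[] := truncn_itv (divr_ge0 (normr_ge0 (W d - W 0)) (ltW b0)).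
    have h2 : (k%:R : R) <= 2 ^+ k by rewrite -natrX ler_nat ltnW // ltn_expl.
    by rewrite mulrC -ler_pdivrMr //; apply: ltW; exact: lt_le_trans h2.
  have dk : d < d + tau k by rewrite ltrDl.
  have := width_concave nu 0 d (d + tau k) Knu (lexx 0) d0 dk; rewrite !subr0 -!/(W _).
  rewrite [d + tau k - d]addrC addKr => hc.
  have h3 : d * (W (d + tau k) - W d) <= tau k * X.
    have : tau k * (W d - W 0) <= tau k * X by rewrite ler_pM2l // ler_norm.
    opaque_lra.
  have h4 : tau k * X <= d * b.
    have z0 : 0 < 2 ^+ k :> R by rewrite exprn_gt0.
    have : tau k * X <= tau k * (b * 2 ^+ k) by rewrite ler_pM2l.
    have -> : tau k * (b * 2 ^+ k) = d * b / 8 by rewrite /tau; opaque_field; rewrite gt_eqF.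
    have : 0 < d * b by rewrite mulr_gt0.
    opaque_lra.
  have : W (d + tau k) - W d <= b by rewrite -(ler_pM2l d0); apply: le_trans h4.
  opaque_lra.
case: (ex_minnP exk) => k hk kmin {exk}.
set t := tau k in hk; have t0 : 0 < t by exact: tau0.
have td : t <= d / 8.
  by rewrite /t /tau ler_pdivrMr ?exprn_gt0 // ler_peMr ?exprn_ege1 ?ler1n // ltW // divr_gt0.
pose Qs := tailq nu (d + t) (2 * e) (b / 2).
have s0 : 0 <= d + t by rewrite addr_ge0 // ltW.
have se2 : d + t < 2 * e by opaque; clear - K0 Kcl Kcv Kb sigma0 td de e0 d0; lra.
have e20 : 0 < 2 * e by rewrite mulr_gt0.
have b20 : 0 < b / 2 by rewrite divr_gt0.
have tQs : tame n Qs by exact: tame_tailq.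
have Qs1 x : lserr nu x <= d + t -> 1 <= Qs x.
  apply: tailq_ge1 => //; rewrite -/(W _) -/(W (d + t)); apply: le_trans hk.
  have : (d + t) * (2 * e - (d + t)) / sigma <= 9 / (4 * c) * b.
    rewrite ler_pdivrMr // -[leRHS]mulrA bE.
    have -> : 9 / (4 * c) * e ^+ 2 = (9 / 8 * d) * (2 * e) by rewrite /d; opaque_field; rewrite gt_eqF.
    by apply: ler_pM => //; opaque; clear - K0 Kcl Kcv Kb sigma0 td de e0 d0 t0 se2; lra.
  by rewrite /T; opaque; clear - K0 Kcl Kcv Kb sigma0; lra.
have EQs : gE n Qs <= 1 / 12.
  apply: (le_trans (gE_tailq nu (d + t) (2 * e) (b / 2) Knu s0 e20 b20)).
  rewrite ler_pdivrMr ?exprn_gt0 //.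
  have : (2 * e + (d + t)) ^+ 2 <= (4 * e) ^+ 2 by rewrite ler_sqr ?nnegrE; opaque; clear - K0 Kcl Kcv Kb sigma0 td de e0 d0 t0 se2; lra.
  have := sqr_ge0 e; opaque; clear - K0 Kcl Kcv Kb sigma0 be2; lra.
suff Em : d <= gE n (lserr nu).
  by apply: le_trans (risk_sqr nu); rewrite ler_sqr ?nnegrE ?(ltW d0) // (le_trans (ltW d0)).
have tm := tame_lserr nu.
case kE : k => [|k'].
  have tE : t = d / 8 by rewrite /t /tau kE expr0 divr1.
  have : gE n (fun x => - (d + t) * Qs x + (d + t)) <= gE n (lserr nu).
    apply: le_gE => // [|x]; first by apply: tameD; [exact: tameZ|exact: tame_cst].
    have [h|h] := leP (lserr nu x) (d + t).
      by have := Qs1 x h; have := lserr_ge0 nu x; opaque_nra.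
    have := tailq_ge0 nu (d + t) (2 * e) (b / 2) x; rewrite -/(Qs x); opaque_nra.
  by rewrite gE_linear // ?gE_cst; [opaque_nra|exact: tame_cst].
have tk : tau k' = 2 * t.
  have z0 : 0 < 2 ^+ k' :> R by rewrite exprn_gt0.
  by rewrite /t /tau kE exprS; opaque_field; rewrite gt_eqF.
have Wb : b <= W (d + 2 * t) - W d.
  have : ~~ (T <= W (2 * e) - W (d + tau k')).
    by apply/negP => /kmin; rewrite kE ltnn.
  by rewrite -ltNge tk; opaque_lra.
pose J := (k' + 4)%N.
have JE : 2 ^+ J * t = d.
  have z0 : 0 < 2 ^+ k' :> R by rewrite exprn_gt0.
  by rewrite /J /t /tau kE exprS exprD; opaque_field; rewrite gt_eqF.
pose rj j := d - 2 ^+ j * t.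
have rj0 j : (j < J)%N -> 0 <= rj j.
  by move=> jJ; rewrite subr_ge0 -[leRHS]JE ler_pM2r // ler_weXn2l ?ler1n // ltnW.
pose Q j := tailq nu (rj j) (d + 2 * t) (2 ^+ j * b / 4).
have q0 : 0 < d + 2 * t by rewrite addr_gt0 // mulr_gt0.
have z1 j : 1 <= 2 ^+ j :> R by rewrite exprn_ege1 // ler1n.
have g0 j : 0 < 2 ^+ j * b / 4 by rewrite divr_gt0 // mulr_gt0 // exprn_gt0.
have tQ j : (j < J)%N -> tame n (Q j) by move=> jJ; apply: tame_tailq => //; exact: rj0.
have Q1 j x : (j < J)%N -> lserr nu x <= rj j -> 1 <= Q j x.
  move=> jJ; have r0 := rj0 j jJ; have zj := z1 j.
  have rd : rj j < d by rewrite /rj ltrBlDr ltrDl mulr_gt0 // exprn_gt0.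
  have dq : d < d + 2 * t by rewrite ltrDl mulr_gt0.
  apply: tailq_ge1 => //; first exact: lt_trans dq.
  rewrite -!/(W _).
  have := width_concave nu (rj j) d (d + 2 * t) Knu r0 rd dq; rewrite -!/(W _).
  have -> : d - rj j = 2 ^+ j * t by rewrite /rj; ring.
  have -> : d + 2 * t - d = 2 * t by ring.
  have qrE : d + 2 * t - rj j = (2 ^+ j + 2) * t by rewrite /rj; ring.
  rewrite qrE; set z := 2 ^+ j in zj *.
  set A := W (d + 2 * t); set B := W d; set C := W (rj j) => hc.
  have h1 : z * (A - B) <= 2 * (B - C).
    by rewrite -(ler_pM2l t0); opaque; clear - K0 Kcl Kcv Kb sigma0 hc; lra.
  have h2 : z * b <= z * (A - B) by rewrite ler_pM2l ?(lt_le_trans ltr01).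
  have h3 : rj j * ((z + 2) * t) / sigma <= (z + 2) * b / 8.
    rewrite ler_pdivrMr //.
    have -> : (z + 2) * b / 8 * sigma = (z + 2) * (e * (e / 8)).
      by rewrite mulrAC -[_ * b * sigma]mulrA bE; opaque_field.
    rewrite mulrCA ler_pM2l; last by opaque; clear - K0 Kcl Kcv Kb sigma0 zj; lra.
    by apply: ler_pM => //; opaque; clear - K0 Kcl Kcv Kb sigma0 rd de td d0 t0 e0; lra.
  have zb : 0 <= z * b by rewrite mulr_ge0 ?(ltW b0) // (le_trans ler01).
  have AB : b <= A - B by exact: Wb.
  opaque; clear - K0 Kcl Kcv Kb sigma0 h1 h2 h3 AB zb b0; lra.
have EQ j : (j < J)%N -> gE n (Q j) <= 3^-1 / (2 ^+ j) ^+ 2.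
  move=> jJ; apply: (le_trans (gE_tailq nu (rj j) (d + 2 * t) _ Knu (rj0 j jJ) q0 (g0 j))).
  have z0 : 0 < 2 ^+ j :> R by rewrite exprn_gt0.
  rewrite ler_pdivrMr ?exprn_gt0 //.
  have -> : 3^-1 / (2 ^+ j) ^+ 2 * (2 ^+ j * b / 4) ^+ 2 = b ^+ 2 / 48 by opaque_field; rewrite gt_eqF.
  have : (d + 2 * t + rj j) ^+ 2 <= (4 * e) ^+ 2.
    rewrite ler_sqr ?nnegrE; [|by have := rj0 j jJ; opaque; clear - K0 Kcl Kcv Kb sigma0 q0; lra|by opaque; clear - K0 Kcl Kcv Kb sigma0 e0; lra].
    rewrite /rj; have : 0 < 2 ^+ j * t by rewrite mulr_gt0.
    by opaque; clear - K0 Kcl Kcv Kb sigma0 de td d0; lra.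
  have := sqr_ge0 e; opaque; clear - K0 Kcl Kcv Kb sigma0 be2; lra.
pose S x := \sum_(j < J) 2 ^+ j * t * Q j x.
have tS : tame n S by apply: tame_sum => j; apply: tameZ; exact: tQ.
have ES : gE n S <= 2 / 3 * t.
  rewrite gE_sum; last by move=> j; apply: tameZ; exact: tQ.
  apply: (@le_trans _ _ (\sum_(j < J) t / 3 * 2^-1 ^+ j)).
    apply: ler_sum => j _; rewrite gEZ; last exact: tQ.
    have z0 : 0 < 2 ^+ j :> R by rewrite exprn_gt0.
    apply: (@le_trans _ _ (2 ^+ j * t * (3^-1 / (2 ^+ j) ^+ 2))).
      by rewrite (ler_pM2l (mulr_gt0 z0 t0)); exact: (EQ j (ltn_ord j)).
    by rewrite exprVn le_eqVlt; apply/orP; left; apply/eqP; opaque_field; rewrite gt_eqF.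
  have -> : 2 / 3 * t = t / 3 * 2 by opaque_field.
  by rewrite -mulr_sumr ler_pM2l ?sum_half_le2 // divr_gt0.
have pw x : - (2 * t) * Qs x + ((d + t) - S x) <= lserr nu x.
  have Qs0 := tailq_ge0 nu (d + t) (2 * e) (b / 2) x; rewrite -/(Qs x) in Qs0.
  have Qj0 j : 0 <= Q j x by exact: tailq_ge0.
  have S0 : 0 <= S x by apply: sumr_ge0 => j _; rewrite mulr_ge0 // mulr_ge0 ?exprn_ge0 // ltW.
  have [h|h] := leP (lserr nu x) (d + t); last by opaque_nra.
  have Q1x := Qs1 x h.
  have hh : d - lserr nu x <= t + S x.
    apply: (dyadic_cover _ t (fun j => Q j x) J t0 Qj0) => [j jJ hj|].
      by apply: Q1 => //; rewrite /rj; opaque; clear - K0 Kcl Kcv Kb sigma0 hj; lra.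
    by rewrite JE; have m0 := lserr_ge0 nu x; opaque; clear - K0 Kcl Kcv Kb sigma0 m0; lra.
  have tQ1 : t <= t * Qs x by rewrite ler_peMr // ltW.
  opaque; clear - K0 Kcl Kcv Kb sigma0 hh tQ1; lra.
have tdS : tame n (fun x => (d + t) - S x) by apply: tameB => //; exact: tame_cst.
have : gE n (fun x => - (2 * t) * Qs x + ((d + t) - S x)) <= gE n (lserr nu).
  by apply: le_gE => //; apply: tameD => //; exact: tameZ.
rewrite gE_linear // gEB //; last exact: tame_cst.
rewrite gE_cst; opaque_nra.
Qed.

End LocalSup.

(** * Risk bounds *)

Section ErrorBound.
Context {R : realType}.

Lemma sqr_convex_bound (kap rho S : R) : 0 < kap -> kap < 1 ->
  ((1 - kap) * rho + S) ^+ 2 <= (1 - kap) * rho ^+ 2 + S ^+ 2 / kap.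
Proof.
move=> k0 k1; rewrite -subr_ge0.
have -> : (1 - kap) * rho ^+ 2 + S ^+ 2 / kap - ((1 - kap) * rho + S) ^+ 2 =
  (1 - kap) * kap * (rho - S / kap) ^+ 2 by field; rewrite gt_eqF.
by rewrite mulr_ge0 ?sqr_ge0 // mulr_ge0 ?(ltW k0) // subr_ge0 ltW.
Qed.

Lemma linear_error_bound (p rho v e : R) : 0 < p -> p < 1 -> 0 < rho -> 0 <= v ->
  e * (p * (1 - p / 4)) <= v + p * (2 - p) / 2 * rho ->
  e <= (1 - p ^+ 2 / 4) * rho + 2 * v / p.
Proof.
move=> p0 p1 rho0 v0 h.
have a0 : 0 < p * (1 - p / 4) by rewrite mulr_gt0 //; lra.
rewrite -(ler_pM2r a0); apply: (le_trans h).
have -> : ((1 - p ^+ 2 / 4) * rho + 2 * v / p) * (p * (1 - p / 4)) =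
  (1 - p ^+ 2 / 4) * (p * (1 - p / 4)) * rho + v * (2 - p / 2) by field; rewrite gt_eqF.
have h1 : v <= v * (2 - p / 2) by rewrite ler_peMr //; lra.
have h2 : p * (2 - p) / 2 * rho <= (1 - p ^+ 2 / 4) * (p * (1 - p / 4)) * rho.
  rewrite ler_pM2r //.
  have -> : (1 - p ^+ 2 / 4) * (p * (1 - p / 4)) = p * ((1 - p ^+ 2 / 4) * (1 - p / 4)) by ring.
  rewrite -mulrA ler_pM2l //.
  have : 0 <= p * (1 - p) by rewrite mulr_ge0 //; lra.
  have : 0 <= p * p * p by rewrite !mulr_ge0 // ltW.
  have -> : (1 - p ^+ 2 / 4) * (1 - p / 4) = 1 - p / 2 + (p * (1 - p) / 4 + p * p * p / 16) by field.
  lra.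
lra.
Qed.

Lemma sqr_error_bound (p rho sg e G D : R) : let kap := p ^+ 2 / 4 in
  0 < p -> p < 1 -> 0 < rho -> 0 < sg -> 0 <= e ->
  ((1 - kap) * rho <= e -> e * ((1 - kap) * rho - (1 - p) * rho) <= sg * G) ->
  D <= (1 - (1 - p) ^+ 2) * rho ^+ 2 / (2 * sg) ->
  e ^+ 2 <= (1 - kap) * rho ^+ 2 + sg ^+ 2 / (kap ^+ 2 * rho ^+ 2) * (G - D) ^+ 2.
Proof.
move=> kap p0 p1 rho0 sg0 e0 hG hD.
have kap0 : 0 < kap by rewrite /kap divr_gt0 // exprn_gt0.
have kap1 : kap < 1 by rewrite /kap ltr_pdivrMr // mul1r; nra.
have pn0 : p != 0 by rewrite gt_eqF.
have rn0 : rho != 0 by rewrite gt_eqF.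
have kn0 : kap != 0 by rewrite gt_eqF.
pose v := sg * `|G - D| / rho.
have v0 : 0 <= v by rewrite /v divr_ge0 ?(ltW rho0) // mulr_ge0 // ltW.
have le : e <= (1 - kap) * rho + 2 * v / p.
  have r0 : 0 <= 2 * v / p by rewrite divr_ge0 ?(ltW p0) // mulr_ge0.
  have [h|h] := leP ((1 - kap) * rho) e; last by clearbody kap v; lra.
  apply: linear_error_bound => //; have := hG h.
  have -> : e * ((1 - kap) * rho - (1 - p) * rho) = e * (p * (1 - p / 4)) * rho by rewrite /kap; field.
  move=> {}h; rewrite -(ler_pM2r rho0); apply: (le_trans h).
  have -> : (v + p * (2 - p) / 2 * rho) * rho = sg * `|G - D| + p * (2 - p) / 2 * rho ^+ 2.
    by rewrite /v; field.
  have h1 : sg * D <= p * (2 - p) / 2 * rho ^+ 2.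
    rewrite mulrC -ler_pdivlMr //; apply: (le_trans hD).
    by rewrite le_eqVlt; apply/orP; left; apply/eqP; field; rewrite gt_eqF.
  have h2 : sg * (G - D) <= sg * `|G - D| by rewrite ler_pM2l // ler_norm.
  clearbody kap v; lra.
have -> : sg ^+ 2 / (kap ^+ 2 * rho ^+ 2) * (G - D) ^+ 2 = (2 * v / p) ^+ 2 / kap.
  rewrite -[(G - D) ^+ 2]real_normK ?num_real // /v /kap; field.
  by rewrite pn0 rn0.
apply: le_trans (sqr_convex_bound kap rho (2 * v / p) kap0 kap1).
rewrite ler_sqr ?nnegrE //; exact: le_trans le.
Qed.

Lemma two_point_arith (s V E r h : R) : 0 <= V -> s - V <= E -> E ^+ 2 <= expR h * r ->
  h <= 1 -> 0 <= E -> 0 <= r -> r <= V ^+ 2 -> s <= 3 * V.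
Proof.
move=> V0 sE Er h1 E0 r0 rV.
have e4 : expR h <= 4 by apply: (le_trans _ expR1_le4); rewrite ler_expR.
have : E ^+ 2 <= (2 * V) ^+ 2.
  apply: (le_trans Er); rewrite exprMn; apply: ler_pM => //; lra.
by rewrite ler_sqr ?nnegrE ?mulr_ge0 //; lra.
Qed.

End ErrorBound.

Section RiskBounds.
Context {R : realType}.
Variables (n : nat) (K : set 'rV[R]_n).
Hypotheses (K0 : K !=set0) (Kcl : closed K) (Kcv : convex_setE K) (Kb : ebounded K).
Variables (sigma : R).
Hypothesis sigma0 : 0 < sigma.

Definition kappa (c : R) : R := (1 - c^-1) ^+ 2 / 4.

Lemma kappa_gt0 (c : R) : 1 < c -> 0 < kappa c.
Proof.
move=> c1; rewrite divr_gt0 // exprn_gt0 // subr_gt0 invf_lt1 //; exact: lt_trans c1.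
Qed.

Lemma risk_upper mu (c rho : R) : K mu -> 1 < c -> 7 * sigma / kappa c ^+ 2 <= rho ->
  width n K mu rho - width n K mu (rho / c) <= (1 - c^-1 ^+ 2) * rho ^+ 2 / (2 * sigma) ->
  risk n K sigma mu <= rho ^+ 2.
Proof.
move=> Kmu c1 hrho; set D := _ - _ => hD.
have c0 : 0 < c by exact: lt_trans c1.
have k0 := kappa_gt0 c c1.
have ci0 : 0 < c^-1 by rewrite invr_gt0.
have ci1 : c^-1 < 1 by rewrite invf_lt1.
set kap := kappa c in k0 hrho.
have rho0 : 0 < rho by apply: lt_le_trans hrho; rewrite divr_gt0 ?exprn_gt0 // mulr_gt0.
have rc0 : 0 <= rho / c by rewrite divr_ge0 // ltW.
have kap1 : kap <= 1 / 4.
  rewrite /kap /kappa ler_pdivrMr //.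
  have : (1 - c^-1) ^+ 2 <= 1 ^+ 2 by rewrite ler_sqr ?nnegrE ?subr_ge0 ?ler01 ?(ltW ci1) // gerBl ltW.
  by rewrite expr1n; lra.
pose g x := (lsup n K mu rho x - lsup n K mu (rho / c) x - D) ^+ 2.
have [tg Eg] := lsupB_variance n K Kb mu (rho / c) rho Kmu rc0 rho0.
pose A := sigma ^+ 2 / (kap ^+ 2 * rho ^+ 2).
have pw x : lserr n K sigma mu x ^+ 2 <= A * g x + (1 - kap) * rho ^+ 2.
  rewrite addrC; apply: (sqr_error_bound (1 - c^-1)) => //.
  - by rewrite subr_gt0.
  - by rewrite gtrBl.
  - exact: lserr_ge0.
  - rewrite -/(kappa c) -/kap => he.
    have cE : (1 - (1 - c^-1)) * rho = rho / c by rewrite subKr mulrC.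
    rewrite cE.
    have rr : rho / c < (1 - kap) * rho.
      rewrite mulrC ltr_pM2r // /kap /kappa.
      have : (1 - c^-1) * (1 - (1 - c^-1) / 4) > 0 by rewrite mulr_gt0 //; lra.
      by lra.
    have re : rho / c < lserr n K sigma mu x by exact: lt_le_trans he.
    apply: (le_trans (lsup_increment_ge n K K0 Kcl Kcv Kb sigma sigma0 mu x (rho / c) ((1 - kap) * rho) Kmu rc0 re (ltW rr) he)).
    rewrite ler_pM2l // lerD2r; apply: lsup_mono => //.
    + by rewrite mulr_ge0 ?(ltW rho0) // subr_ge0; lra.
    + by rewrite ler_piMl ?(ltW rho0) // gerBl ltW.
  - by rewrite subKr.
have tr := tame_lserr2 n K K0 Kcl Kcv Kb sigma sigma0 mu.
have : risk n K sigma mu <= gE n (fun x => A * g x + (1 - kap) * rho ^+ 2).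
  by apply: le_gE => //; apply: tameD; [exact: tameZ|exact: tame_cst].
rewrite gE_linear //; last exact: tame_cst.
rewrite gE_cst => h; apply: (le_trans h).
have A0 : 0 < A by apply: divr_gt0; [|apply: mulr_gt0]; exact: exprn_gt0.
have : A * gE n g <= A * (48 * rho ^+ 2).
  rewrite ler_pM2l //; apply: (le_trans Eg).
  have : (rho + rho / c) ^+ 2 <= (2 * rho) ^+ 2.
    rewrite ler_sqr ?nnegrE ?mulr_ge0 ?addr_ge0 ?(ltW rho0) //.
    have : rho / c <= rho by rewrite ler_pdivrMr // ler_peMr // ltW.
    by lra.
  by lra.
have -> : A * (48 * rho ^+ 2) = 48 * sigma ^+ 2 / kap ^+ 2 by rewrite /A; field; rewrite !gt_eqF.
have : 48 * sigma ^+ 2 / kap ^+ 2 <= kap * rho ^+ 2.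
  have h1 : (7 * sigma / kap ^+ 2) ^+ 2 <= rho ^+ 2.
    by rewrite ler_sqr ?nnegrE ?(ltW rho0) // divr_ge0 ?sqr_ge0 // mulr_ge0 // ltW.
  apply: (@le_trans _ _ (kap * (7 * sigma / kap ^+ 2) ^+ 2)); last by rewrite ler_pM2l.
  have -> : kap * (7 * sigma / kap ^+ 2) ^+ 2 = (49 * sigma ^+ 2 / kap ^+ 2) / kap by field; rewrite gt_eqF.
  rewrite ler_pdivlMr //.
  have s2 : 0 < sigma ^+ 2 / kap ^+ 2 by rewrite divr_gt0 // exprn_gt0.
  rewrite -!(mulrA _ (sigma ^+ 2)) -mulrA; set s := sigma ^+ 2 / _ in s2 *.
  clearbody s kap; nra.
clearbody kap; lra.
Qed.

Lemma two_point_risk p q (V : R) : K p -> K q -> enorm (q - p) <= sigma -> 0 <= V ->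
  risk n K sigma p <= V ^+ 2 -> risk n K sigma q <= V ^+ 2 -> enorm (q - p) <= 3 * V.
Proof.
move=> Kp Kq qp V0 rp rq.
pose phi x := enorm (lse K (p + sigma *: x) - q).
have s0 := ltW sigma0.
have l2 : lip2 n sigma phi.
  move=> x y; apply: (le_trans (enorm_dist _ _ _)).
  rewrite opprB addrA subrK.
  apply: (le_trans (lse_nonexpansive _ _ K0 Kcl Kcv Kb _ _)).
  by rewrite opprD addrACA subrr add0r -scalerBr enormZ gtr0_norm.
have tphi : tame n phi := tame_lip1 _ _ _ s0 (lip2_lip1 _ _ _ s0 l2).
have tp := tame_lserr n K K0 Kcl Kcv Kb sigma sigma0 p.
have h1 : enorm (q - p) - V <= gE n phi.
  apply: (@le_trans _ _ (gE n (fun x => enorm (q - p) - lserr n K sigma p x))).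
    rewrite gEB //; last exact: tame_cst.
    rewrite gE_cst lerD2l lerN2.
    have e0 : 0 <= gE n (lserr n K sigma p) by apply: gE_ge0 => // x; exact: lserr_ge0.
    rewrite -ler_sqr ?nnegrE //; apply: le_trans rp.
    exact: risk_sqr.
  apply: le_gE => // [|x]; first by apply: tameB => //; exact: tame_cst.
  rewrite lerBlDr /phi /lserr; set m := lse K _.
  by have := enorm_triangle _ m q p; rewrite (enormB _ q m).
pose h := sigma^-1 *: (q - p).
have hE x : p + sigma *: (x + h) = q + sigma *: x.
  by rewrite /h scalerDr scalerA divff ?gt_eqF // scale1r addrCA addrC subrKC addrC.
have hh : dotv h h <= 1.
  have s1 : sigma^-1 * enorm (q - p) <= 1 by rewrite mulrC ler_pdivrMr // mul1r.
  rewrite -enorm_sqr /h enormZ gtr0_norm ?invr_gt0 // expr_le1 //.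
  by rewrite mulr_ge0 ?invr_ge0 ?enorm_ge0.
have h2 := gE_shift_sqr n phi h tphi (fun x => enorm_ge0 _ _).
have e2 : (fun x => phi (x + h) ^+ 2) = (fun x => lserr n K sigma q x ^+ 2).
  by apply/funext => x; rewrite /phi hE.
rewrite e2 -/(risk n K sigma q) in h2.
have p0 : 0 <= gE n phi := gE_ge0 _ _ tphi (fun x => enorm_ge0 _ _).
exact: (two_point_arith _ _ _ _ _ V0 h1 h2 hh p0 (risk_ge0 _ _ K0 Kcl Kcv Kb _ sigma0 q) rq).
Qed.

End RiskBounds.

(** * Minimax risk and the threshold radius *)

Section Minimax.
Context {R : realType}.
Variables (n : nat) (K : set 'rV[R]_n).
Hypotheses (K0 : K !=set0) (Kcl : closed K) (Kcv : convex_setE K) (Kb : ebounded K).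

Lemma enorm_le_diam x y : K x -> K y -> enorm (x - y) <= diam K.
Proof.
move=> Kx Ky; apply: ub_le_sup; last by exists x => //; exists y.
have [M KM] := Kb; exists (M + M) => _ [u Ku [v Kv <-]].
apply: (le_trans (enormD _ _ _)); rewrite enormN.
by apply: lerD; exact: KM.
Qed.

Lemma diam_ge0 : 0 <= diam K.
Proof. by have [x Kx] := K0; have := enorm_le_diam _ _ Kx Kx; rewrite subrr enorm0. Qed.

Lemma exists_far_points (d : R) : d < diam K -> exists x y, [/\ K x, K y & d < enorm (x - y)].
Proof.
move=> dd; have [|_ [x Kx [y Ky <-]] h] := sup_gt _ dd; last by exists x, y.
by have [x Kx] := K0; exists (enorm (x - x)), x => //; exists x.
Qed.

Lemma lgwE mu (e : R) : K mu -> 0 <= e -> lgw K mu e = (width n K mu e)%:E.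
Proof. by move=> Kmu e0; apply: gauss_expE; exact: (tame_lsup n K Kb). Qed.

Section FixedNoise.
Variable sigma : R.
Hypothesis sigma0 : 0 < sigma.

Lemma minimax_sqE : minimax_sq K sigma = ereal_sup [set (risk n K sigma mu)%:E | mu in K].
Proof.
congr ereal_sup; apply: eq_imagel => mu Kmu.
by apply: gauss_expE; exact: (tame_lserr2 n K K0 Kcl Kcv Kb).
Qed.

Lemma risk_le_diam mu : K mu -> risk n K sigma mu <= diam K ^+ 2.
Proof.
move=> Kmu; rewrite -(gE_cst n (diam K ^+ 2)); apply: le_gE => [||x].
- exact: (tame_lserr2 n K K0 Kcl Kcv Kb).
- exact: tame_cst.
rewrite ler_sqr ?nnegrE ?lserr_ge0 ?diam_ge0 //.
by apply: enorm_le_diam => //; exact: lse_in.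
Qed.

Lemma minimax_sq_fin_num : minimax_sq K sigma \is a fin_num.
Proof.
have [mu Kmu] := K0; rewrite minimax_sqE fin_numElt; apply/andP; split.
  apply: (@lt_le_trans _ _ (risk n K sigma mu)%:E); first by rewrite ltNyr.
  by apply: ereal_sup_ubound; exists mu.
apply: (@le_lt_trans _ _ (diam K ^+ 2)%:E); last by rewrite ltry.
by apply: ge_ereal_sup => _ [nu Knu <-]; rewrite lee_fin risk_le_diam.
Qed.

Lemma epsK_sqr : (epsK K sigma ^+ 2)%:E = minimax_sq K sigma.
Proof.
rewrite /epsK sqr_sqrtr ?fineK ?minimax_sq_fin_num //.
have [mu Kmu] := K0; apply: fine_ge0; rewrite minimax_sqE.
apply: (@le_trans _ _ (risk n K sigma mu)%:E).
  by rewrite lee_fin; exact: (risk_ge0 n K K0 Kcl Kcv Kb).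
by apply: ereal_sup_ubound; exists mu.
Qed.

Lemma epsK_ge0 : 0 <= epsK K sigma.
Proof. exact: sqrtr_ge0. Qed.

Lemma risk_le_epsK mu : K mu -> risk n K sigma mu <= epsK K sigma ^+ 2.
Proof.
move=> Kmu; rewrite -lee_fin epsK_sqr minimax_sqE.
by apply: ereal_sup_ubound; exists mu.
Qed.

Lemma epsK_le (B : R) : 0 <= B -> (forall mu, K mu -> risk n K sigma mu <= B ^+ 2) ->
  epsK K sigma <= B.
Proof.
move=> B0 h; rewrite -ler_sqr ?nnegrE ?epsK_ge0 // -lee_fin epsK_sqr minimax_sqE.
by apply: ge_ereal_sup => _ [mu Kmu <-]; rewrite lee_fin h.
Qed.

Lemma epsK_le_diam : epsK K sigma <= diam K.
Proof. by apply: epsK_le; [exact: diam_ge0|exact: risk_le_diam]. Qed.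

Lemma min_le_epsK : 6^-1 * Num.min sigma (diam K) <= epsK K sigma.
Proof.
have e0 := epsK_ge0; set m := Num.min _ _.
have [m0|m0] := leP m 0.
  by apply: le_trans e0; rewrite mulr_ge0_le0.
have md : m <= diam K by rewrite ge_min lexx orbT.
have ms : m <= sigma by rewrite ge_min lexx.
have [|x [y [Kx Ky xy]]] := exists_far_points (m / 2); first by clearbody m; lra.
have e1 : 0 < enorm (x - y) by apply: lt_trans xy; rewrite divr_gt0.
pose l := m / 2 / enorm (x - y).
have l01 : 0 <= l <= 1.
  by apply: frac_itv => //; [rewrite divr_ge0 // ltW|exact: ltW].
have Kq := Kcv _ _ Kx Ky _ l01; set q := l *: x + (1 - l) *: y in Kq.
have qy : enorm (q - y) = m / 2.
  have -> : q - y = l *: (x - y) by apply/rowP => i; rewrite !mxE; ring.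
  have /andP[l0 _] := l01.
  by rewrite enormZ ger0_norm // /l divfK // gt_eqF.
have := two_point_risk n K K0 Kcl Kcv Kb sigma sigma0 y q (epsK K sigma) Ky Kq.
rewrite qy => /(_ _ e0 (risk_le_epsK _ Ky) (risk_le_epsK _ Kq)) h.
have {}h : m / 2 <= 3 * epsK K sigma by apply: h; clearbody m; lra.
move: (epsK K sigma) h => E h; clearbody m; lra.
Qed.

End FixedNoise.

Section Threshold.
Variables (c sigma : R).
Hypotheses (c1 : 1 < c) (sigma0 : 0 < sigma).

Definition epsbar_set : set R := [set e : R | 0 <= e /\
     (ereal_sup [set (lgw K mu e -
                      ereal_inf [set lgw K nu (e / c) | nu in eball mu e `&` K])%E
                 | mu in K]
      >= ((4 + 4 / c) * (e ^+ 2 / (2 * sigma)))%:E)%E].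

Let c0 : 0 < c. Proof. exact: lt_trans c1. Qed.

Lemma epsbar_set_intro mu (e : R) : K mu -> 0 <= e ->
  (4 + 4 / c) * (e ^+ 2 / (2 * sigma)) <= width n K mu e - width n K mu (e / c) ->
  epsbar_set e.
Proof.
move=> Kmu e0 h; split => //.
have ec0 : 0 <= e / c by rewrite divr_ge0 // ltW.
apply: (@le_trans _ _ (width n K mu e - width n K mu (e / c))%:E); first by rewrite lee_fin.
apply: (@le_trans _ _ (lgw K mu e - ereal_inf [set lgw K nu (e / c) | nu in eball mu e `&` K])%E).
  rewrite EFinB -!lgwE //; apply: leeB => //.
  by apply: ereal_inf_lbound; exists mu => //; split => //; rewrite /eball /= subrr enorm0.
by apply: ereal_sup_ubound; exists mu.
Qed.

Lemma epsbar_set_elim (e eta : R) : epsbar_set e -> 0 < eta ->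
  exists nu, K nu /\
    (4 + 4 / c) * (e ^+ 2 / (2 * sigma)) - eta < width n K nu (2 * e) - width n K nu (e / c).
Proof.
move=> [e0 he] eta0; set a := _ * _ in he *.
have ec0 : 0 <= e / c by rewrite divr_ge0 // ltW.
have e20 : 0 <= 2 * e by rewrite mulr_ge0.
apply: contrapT => hn.
have {}hn nu : K nu -> width n K nu (2 * e) - width n K nu (e / c) <= a - eta.
  by move=> Knu; rewrite leNgt; apply/negP => h; apply: hn; exists nu.
suff : (a%:E <= (a - eta)%:E)%E by rewrite lee_fin; clearbody a; lra.
apply: (le_trans he); apply: ge_ereal_sup => _ [mu Kmu <-].
have h : ((width n K mu e - (a - eta))%:E <= ereal_inf [set lgw K nu (e / c) | nu in eball mu e `&` K])%E.
  apply: le_ereal_inf_tmp => _ [nu [nue Knu] <-]; rewrite lgwE // lee_fin.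
  have : width n K mu e <= width n K nu (2 * e).
    apply: le_gE; [exact: (tame_lsup n K Kb)|exact: (tame_lsup n K Kb)|move=> x].
    apply: (lsup_subball n K Kb) => //; rewrite enormB.
    by move: nue; rewrite /eball /=; lra.
  by have := hn nu Knu; clearbody a; lra.
rewrite lgwE //; apply: (le_trans (leeB (lexx _) h)).
by rewrite -EFinB lee_fin; clearbody a; lra.
Qed.

Lemma epsbar_set_nonempty : epsbar_set !=set0.
Proof.
have [mu Kmu] := K0; exists 0; apply: (epsbar_set_intro mu) => //.
by rewrite expr0n /= !mul0r mulr0 subrr.
Qed.

Lemma lsup_abs_le (M : R) mu r x : (forall t, K t -> enorm t <= M) -> K mu -> 0 <= r ->
  - (M * enorm x) <= lsup n K mu r x /\ lsup n K mu r x <= M * enorm x.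
Proof.
move=> KM Kmu r0; split.
  apply: (@le_trans _ _ (dotv x mu)); last first.
    by apply: (lsup_ub n K Kb) => //; rewrite subrr enorm0.
  rewrite lerNl; have := cauchy_schwarz n (- x) mu; rewrite dotvNl enormN => /le_trans; apply.
  by rewrite mulrC ler_wpM2r ?enorm_ge0 // KM.
apply: lsup_le => // t Kt _; apply: (le_trans (cauchy_schwarz _ _ _)).
by rewrite mulrC ler_wpM2r ?enorm_ge0 // KM.
Qed.

Lemma epsbar_set_ubound : has_ubound epsbar_set.
Proof.
have [M KM] := Kb.
have te : tame n (fun x : 'rV[R]_n => enorm x).
  apply: (tame_lip1 _ 1) => //; apply: lip2_lip1 => // x y; rewrite mul1r.
  exact: enorm_dist.
pose B := 2 * M * gE n (fun x : 'rV[R]_n => enorm x).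
exists (1 + (B + 1) * sigma / 2) => e Se; have [e0 _] := Se.
have [nu [Knu h]] := epsbar_set_elim e 1 Se ltr01.
have ec0 : 0 <= e / c by rewrite divr_ge0 // ltW.
have e20 : 0 <= 2 * e by rewrite mulr_ge0.
have hB : width n K nu (2 * e) - width n K nu (e / c) <= B.
  rewrite /B -gEZ // -(gE_lsupB n K Kb) //; apply: le_gE => [||x].
  - by apply: tameB; exact: (tame_lsup n K Kb).
  - exact: tameZ.
  have [_ h1] := lsup_abs_le M nu (2 * e) x KM Knu e20.
  have [h2 _] := lsup_abs_le M nu (e / c) x KM Knu ec0.
  move: h1 h2; move: (lsup _ _ _ _ _) (lsup _ _ _ _ _) (enorm x) => u v w; lra.
have {h hB} h : (4 + 4 / c) * (e ^+ 2 / (2 * sigma)) - 1 < B by exact: lt_le_trans hB.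
have : 4 * (e ^+ 2 / (2 * sigma)) <= (4 + 4 / c) * (e ^+ 2 / (2 * sigma)).
  rewrite ler_wpM2r ?lerDl ?divr_ge0 ?sqr_ge0 ?mulr_ge0 ?(ltW c0) ?(ltW sigma0) //.
have -> : 4 * (e ^+ 2 / (2 * sigma)) = 2 * e ^+ 2 / sigma by field; rewrite gt_eqF.
move=> h2; have : 2 * e ^+ 2 / sigma <= B + 1 by clearbody B; lra.
rewrite ler_pdivrMr // => h3; have := sqr_ge0 (e - 1); clearbody B; nra.
Qed.

Lemma le_epsbar (e : R) : epsbar_set e -> e <= epsbar K c sigma.
Proof. by move=> Se; apply: ub_le_sup => //; exact: epsbar_set_ubound. Qed.

Lemma lt_epsbar (t : R) : t < epsbar K c sigma -> exists2 e, epsbar_set e & t < e.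
Proof. by move=> h; apply: sup_gt => //; exact: epsbar_set_nonempty. Qed.

Lemma epsbar_le_epsK : 101 * sigma <= epsbar K c sigma -> epsbar K c sigma / c <= epsK K sigma.
Proof.
move=> h; rewrite leNgt; apply/negP; rewrite ltr_pdivlMr // => lt.
have {}h : 100 * sigma < epsbar K c sigma by apply: lt_le_trans h; rewrite ltr_pM2r // ltr_nat.
have [|e Se] := lt_epsbar (Num.max (epsK K sigma * c) (100 * sigma)).
  by rewrite gt_max lt h.
rewrite gt_max => /andP[he hs].
have e0 : 0 < e by apply: lt_trans hs; rewrite mulr_gt0.
pose b := e ^+ 2 / sigma; have b0 : 0 < b by rewrite divr_gt0 // exprn_gt0.
have b4 : 0 < b / 4 by rewrite divr_gt0.
have [nu [Knu hn]] := epsbar_set_elim e (b / 4) Se b4.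
have : (e / c) ^+ 2 <= risk n K sigma nu.
  apply: (risk_lower n K K0 Kcl Kcv Kb sigma sigma0 nu c e Knu c1 (ltW hs)).
  apply: le_trans (ltW hn).
  have -> : (4 + 4 / c) * (e ^+ 2 / (2 * sigma)) = (2 + 2 / c) * b by rewrite /b; field; rewrite !gt_eqF.
  rewrite -/b; have -> : 9 / (4 * c) = 9 / 4 * c^-1 by field; rewrite gt_eqF.
  have ci : b * c^-1 <= b by rewrite ler_piMr ?(ltW b0) // invf_le1 // ltW.
  move: ci; clearbody b; move: (c^-1) => y; lra.
move=> /le_trans /(_ (risk_le_epsK sigma sigma0 nu Knu)).
rewrite ler_sqr ?nnegrE ?epsK_ge0 ?divr_ge0 ?(ltW e0) ?(ltW c0) // ler_pdivrMr //.
by rewrite leNgt he.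
Qed.

End Threshold.

Lemma epsK_le_epsbar (c sigma : R) : 1 < c -> 0 < sigma ->
  epsK K sigma <= Num.max (epsbar K c (4 * c * sigma / (c - 1))) (7 * sigma / kappa c ^+ 2).
Proof.
move=> c1 sigma0; rewrite leNgt; apply/negP; set t := Num.max _ _ => lt.
have c0 : 0 < c by exact: lt_trans c1.
have cm0 : 0 < c - 1 by rewrite subr_gt0.
pose s' := 4 * c * sigma / (c - 1); have s'0 : 0 < s' by rewrite divr_gt0 // !mulr_gt0.
pose rho := (t + epsK K sigma) / 2.
have trho : t < rho := (midf_lt lt).1.
have rhoE : rho < epsK K sigma := (midf_lt lt).2.
have k0 := kappa_gt0 c c1.
have hrho : 7 * sigma / kappa c ^+ 2 <= rho.
  by apply: ltW; apply: le_lt_trans trho; rewrite le_max lexx orbT.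
have rho0 : 0 <= rho by apply: le_trans hrho; rewrite divr_ge0 ?sqr_ge0 // mulr_ge0 // ltW.
have : epsK K sigma <= rho.
  apply: epsK_le => // mu Kmu.
  apply: (risk_upper n K K0 Kcl Kcv Kb sigma sigma0 mu c rho Kmu c1 hrho).
  rewrite leNgt; apply/negP => hlt.
  have Sr : epsbar_set c s' rho.
    apply: (epsbar_set_intro _ _ c1 mu) => //; apply: le_trans (ltW hlt).
    rewrite le_eqVlt; apply/orP; left; apply/eqP; rewrite /s'; field.
    by rewrite !gt_eqF.
  have := le_epsbar c s' c1 s'0 rho Sr; rewrite leNgt => /negP; apply.
  by apply: le_lt_trans trho; rewrite le_max lexx.
by rewrite leNgt rhoE.
Qed.

End Minimax.

Theorem mainTheorem7 :
  (forall (R : realType) (c : R), 1 < c ->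
    exists C0 : R, 0 < C0 /\
      forall (n : nat) (K : set 'rV[R]_n) (sigma : R),
        K !=set0 -> closed K -> convex_setE K -> ebounded K -> 0 < sigma ->
        C0 * sigma <= epsbar K c sigma ->
        epsbar K c sigma / c <= epsK K sigma /\
        epsK K sigma <= epsbar K c (4 * c * sigma / (c - 1)))
  /\
  (forall (R : realType) (c : R), 1 < c ->
    forall C1 : R, 0 < C1 ->
    exists C2 C3 : R, 0 < C2 /\ 0 < C3 /\
      forall (n : nat) (K : set 'rV[R]_n) (sigma : R),
        K !=set0 -> closed K -> convex_setE K -> ebounded K -> 0 < sigma ->
        epsbar K c (4 * c * sigma / (c - 1)) <= C1 * sigma ->
        C2 * Num.min sigma (diam K) <= epsK K sigma /\
        epsK K sigma <= C3 * Num.min sigma (diam K)).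
Proof.
split=> R c c1.
  have c0 : 0 < c by exact: lt_trans c1.
  have k0 := kappa_gt0 c c1; pose k := 7 / kappa c ^+ 2.
  have kp : 0 < k by rewrite divr_gt0 // exprn_gt0.
  exists (101 + c * (k + 1)); split.
    by rewrite addr_gt0 // mulr_gt0 // addr_gt0.
  move=> n K sigma K0 Kcl Kcv Kb s0 h.
  have h1 : epsbar K c sigma / c <= epsK K sigma.
    apply: epsbar_le_epsK => //; apply: le_trans h; rewrite ler_pM2r // lerDl.
    by rewrite mulr_ge0 ?(ltW c0) // addr_ge0 // ltW.
  split=> //; have := epsK_le_epsbar n K K0 Kcl Kcv Kb c sigma c1 s0.
  rewrite le_max => /orP[//|h2].
  have : c * (k + 1) * sigma <= epsbar K c sigma.
    by apply: le_trans h; rewrite ler_pM2r // lerDr.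
  have h3 : epsbar K c sigma <= k * sigma * c.
    by rewrite -ler_pdivrMr //; apply: (le_trans h1); apply: (le_trans h2); rewrite mulrAC.
  move=> /le_trans /(_ h3).
  have -> : k * sigma * c = c * k * sigma by ring.
  rewrite ler_pM2r // ler_pM2l // leNgt ltrDl ltr01 //.
move=> C1 C10.
have k0 := kappa_gt0 c c1; pose k := 7 / kappa c ^+ 2.
have kp : 0 < k by rewrite divr_gt0 // exprn_gt0.
exists 6^-1, (C1 + k + 1); split; first by rewrite invr_gt0.
split; first by rewrite !addr_gt0.
move=> n K sigma K0 Kcl Kcv Kb s0 h; split; first exact: min_le_epsK.
have C31 : 1 <= C1 + k + 1 by rewrite lerDr addr_ge0 // ltW.
have h1 : epsK K sigma <= (C1 + k + 1) * sigma.
  have := epsK_le_epsbar n K K0 Kcl Kcv Kb c sigma c1 s0.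
  rewrite le_max => /orP[h2|h2]; apply: (le_trans h2).
    by apply: (le_trans h); rewrite ler_pM2r // -addrA lerDl addr_ge0 // ltW.
  by rewrite mulrAC -/k ler_pM2r // addrAC lerDr addr_ge0 // ltW.
have h2 : epsK K sigma <= (C1 + k + 1) * diam K.
  apply: (le_trans (epsK_le_diam n K K0 Kcl Kcv Kb sigma s0)).
  by rewrite ler_peMl // diam_ge0.
by case: (leP sigma (diam K)) => _.
Qed.
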